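(* Let $m\ge 2$ and let $T$ be an $m$-uniform hypertree with $k$ edges and even diameter $d=2p$. Suppose $k\ge \dfrac{(4d^2-1)(m-1)+2}{4}$. Then: (i) $\lambda_1(T)\le \lambda_1(T_d(c_{p+1}=k-d))$, and equality holds only if $T=T_d(c_{p+1}=k-d)$; (ii) $\lambda_1(T)<\dfrac{m-1+\sqrt{(m-1)^2+4(k-d)(m-1)}}{2m-2}$.
   Context: A hypergraph has a finite vertex set and an edge set of non-empty subsets of the vertex set; it is $m$-uniform if all edges have cardinality $m$, and linear if two distinct edges share at most one vertex. The adjacency matrix of a linear $m$-uniform hypergraph $\mathcal{H}$ has $(i,j)$ entry $\frac{1}{m-1}$ if $i\ne j$ lie in a common edge, and $0$ otherwise; $\lambda_1(\mathcal{H})$ denotes its spectral radius. The degree of a vertex is the number of edges containing it; a vertex is pendant if its degree is one and non-pendant if its degree is larger. A loose path of length $d$, $P_L(d)=v_1e_1v_2e_2\dots v_de_dv_{d+1}$, is the $m$-uniform hypergraph with edges $e_1,\dots,e_d$ such that $e_{i-1}\cap e_i=\{v_i\}$ for $2\le i\le d$ (the $v_i$ distinct), non-consecutive edges are disjoint, and $v_1\in e_1$, $v_{d+1}\in e_d$ are pendant. A loose cycle of length $l\ge3$, $v_1e_1v_2e_2\dots v_le_lv_1$, is the $m$-uniform hypergraph with edges $e_1,\dots,e_l$ in which cyclically consecutive edges meet exactly in $v_i$ ($e_{i-1}\cap e_i=\{v_i\}$, indices mod $l$, the $v_i$ distinct) and non-consecutive edges are disjoint. A hypertree is a connected linear hypergraph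 containing no loose cycle in which every edge contains at most two non-pendant vertices. The diameter is the maximum distance between two vertices, distance being the minimum length (number of edges) of a path joining them. Attaching a pendant edge at a vertex $v$ means adding a new edge consisting of $v$ and $m-1$ new vertices. $T_d(c_2,\dots,c_d)$ is the hypertree obtained from $P_L(d)=v_1e_1v_2\dots v_de_dv_{d+1}$ by attaching $c_i$ pendant edges at $v_i$ for $i=2,\dots,d$; when only some of the $c_i$ are listed, the others are $0$. Equality of hypergraphs means isomorphism. *)

(* Defs.v *)
From HB Require Import structures.
From mathcomp Require Import all_boot all_order all_algebra.
From mathcomp Require Import reals.
From mathcomp Require Import complex.

Set Implicit Arguments.
Unset Strict Implicit.
Unset Printing Implicit Defensive.

Import Order.TTheory GRing.Theory Num.Theory.

Record hypergraph (V : finType) := Hypergraph {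
  edges : {set {set V}};
  edges_neq0 : set0 \notin edges }.

Section Hypergraph.
Variables (V : finType) (H : hypergraph V).

Definition uniform (m : nat) : Prop := forall e, e \in edges H -> #|e| = m.

Definition linear_hypergraph : Prop :=
  forall e f, e \in edges H -> f \in edges H -> e != f -> #|e :&: f| <= 1.

Definition degree (v : V) : nat := #|[set e in edges H | v \in e]|.

Definition non_pendant (v : V) : bool := 1 < degree v.

(* [hpath u [:: (e_1, v_2); ...; (e_n, v_(n+1))]] : the alternating sequence
   u e_1 v_2 ... e_n v_(n+1) is a path, i.e. every e_i contains the vertices
   on both of its sides and neither vertices nor edges are repeated.
   The set0 paired with u is a dummy that the relation ignores. *)
Definition hpath (u : V) (s : seq ({set V} * V)) : bool :=
  [&& path (fun x y => [&& y.1 \in edges H, x.2 \in y.1 & y.2 \in y.1])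
           (set0, u) s,
      uniq (unzip1 s) & uniq (u :: unzip2 s)].

Definition joined_by (u w : V) (n : nat) : Prop :=
  exists s, [/\ hpath u s, last u (unzip2 s) = w & size s = n].

Definition connected_hypergraph : Prop :=
  forall u w, exists n, joined_by u w n.

Definition distance (u w : V) (n : nat) : Prop :=
  joined_by u w n /\ forall n', joined_by u w n' -> n <= n'.

Definition diameter (d : nat) : Prop :=
  (exists u w, distance u w d) /\
  (forall u w n, distance u w n -> n <= d).

(* [v i] is the common vertex of [e (i - 1)] and [e i], indices mod l. *)
Definition loose_cycle (l : nat) (v : 'I_l -> V) (e : 'I_l -> {set V}) : Prop :=
  [/\ 2 < l, injective v /\ injective e,
      forall i, e i \in edges H,
      forall i, e (ord_pred i) :&: e i = [set v i]
    & forall i j, j != i -> j != ordS i -> i != ordS j -> [disjoint e i & e j]].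

Definition hypertree : Prop :=
  [/\ connected_hypergraph, linear_hypergraph,
      (forall l v e, ~ @loose_cycle l v e)
    & forall e, e \in edges H -> #|[set v in e | non_pendant v]| <= 2].

End Hypergraph.

Definition isomorphic (V W : finType) (G : hypergraph V) (H : hypergraph W) :
    Prop :=
  exists2 f : V -> W, bijective f & [set f @: (e : {set V}) | e in edges G] = edges H.

Section LoosePath.
Variables (m d : nat).

(* [inl i] is v_(i+1); [inr (j, a)], a < m - 2, are the vertices of e_(j+1)
   other than v_(j+1) and v_(j+2). *)
Definition loose_path_vertex : finType := ('I_d.+1 + 'I_d * 'I_(m - 2))%type.

Definition loose_path_edge (j : 'I_d) : {set loose_path_vertex} :=
  [set x : loose_path_vertex | match x with
     | inl i => (i == j :> nat) || (i == j.+1 :> nat)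
     | inr ja => ja.1 == j
     end].

Lemma loose_path_neq0 : set0 \notin [set loose_path_edge j | j : 'I_d].
Proof.
apply/imsetP => -[j _ /setP/(_ (inl (widen_ord (leqnSn d) j)))].
by rewrite !inE eqxx.
Qed.

Definition loose_path : hypergraph loose_path_vertex :=
  Hypergraph loose_path_neq0.

End LoosePath.

Section Attach.
Variables (m : nat) (V : finType) (H : hypergraph V) (c : V -> nat).

(* [c v] pendant edges are attached at every vertex v simultaneously;
   [Tagged _ t : {v : V & 'I_(c v)}] is the t-th of those attached at v. *)
Definition attach_vertex : finType :=
  (V + {v : V & 'I_(c v)} * 'I_(m - 1))%type.

Definition attached_edge (vt : {v : V & 'I_(c v)}) : {set attach_vertex} :=
  [set x : attach_vertex | match x with
     | inl v => v == tag vt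
     | inr wb => wb.1 == vt
     end].

Definition attach_edges : {set {set attach_vertex}} :=
  [set [set (inl v : attach_vertex) | v in e] | e : {set V} in edges H]
    :|: [set attached_edge vt | vt : {v : V & 'I_(c v)}].

Lemma attach_neq0 : set0 \notin attach_edges.
Proof.
rewrite !inE negb_or; apply/andP; split; apply/imsetP.
  move=> -[e eH /esym/eqP]; rewrite imset_eq0 => /eqP e0.
  by have := edges_neq0 H; rewrite -e0 eH.
by move=> -[vt _ /setP/(_ (inl (tag vt)))]; rewrite !inE eqxx.
Qed.

Definition attach_pendant_edges : hypergraph attach_vertex :=
  Hypergraph attach_neq0.

End Attach.

(* c_i = c i for 2 <= i <= d, where v_i is the vertex [inl (i - 1)]. *)
Definition Td_mult (m d : nat) (c : nat -> nat) (x : loose_path_vertex m d) :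
    nat :=
  match x with
  | inl i => if 2 <= i.+1 <= d then c i.+1 else 0
  | inr _ => 0
  end.

Definition Td (m d : nat) (c : nat -> nat) :=
  attach_pendant_edges m (loose_path m d) (Td_mult c).

Local Open Scope ring_scope.

Definition adjacency (R : realType) (m : nat) (V : finType)
    (H : hypergraph V) : 'M[R]_#|V| :=
  \matrix_(i, j)
    if (i != j)
       && [exists e in edges H, (enum_val i \in e) && (enum_val j \in e)]
    then (m%:R - 1)^-1 else 0.

(* Supremum of the moduli of the complex eigenvalues ([normc] is the
   R-valued modulus on R[i]). *)
Definition spectral_radius (R : realType) (n : nat) (A : 'M[R]_n) : R :=
  sup (fun r : R => exists2 z : R[i],
         eigenvalue (map_mx (real_complex R) A) z
       & r = ComplexField.Normc.normc z).

Definition lambda1 (R : realType) (m : nat) (V : finType) (H : hypergraph V) :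
    R :=
  spectral_radius (adjacency R m H).

(* Main.v *)
(* Put s = (m - 1) lambda and M = m - 1. Let z >= 0 satisfy s z_v <= sum of z over the
   neighbours of v. If the edges at v other than e carry, outside v, total weight at
   most G z_v, and everything beyond e hangs at v, then e carries outside its other
   end w at most transfer(G) z_w, where transfer is a Moebius map. A pendant edge
   thus contributes leaf = transfer(0), and a loose path of j edges contributes
   ray j, the j-th iterate of transfer at 0.

   For T_d(c_{p+1} = k - d) the value s is a root of s = (k - d) leaf + 2 ray p, and the
   corresponding eigenvector is explicit. For this s and the given range of k, transfer
   is a strict contraction on the values that occur, so a branch with n edges containing
   a path of j edges contributes at most ray j + (n - j) leaf. Root T at a centroid, so
   that no branch has more than (k + 1)/2 edges. If a diametral path passes through the
   root, splitting as a + b = d, strict concavity of ray gives the total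
   ray a + ray b + (k - d) leaf <= s, with equality only for T_d(c_{p+1} = k - d). Otherwise
   the diametral path lies in one branch; a branch with n >= d edges contributes less
   than (n - d + 2) leaf, so again the total is less than s.

   For (ii), ray p <= p leaf places the root s below (m - 1) times the bound as soon as
   that bound exceeds d, which is what the hypothesis on k says. *)

From mathcomp Require Import boolp classical_sets reals complex.
From mathcomp Require Import all_boot all_order all_algebra.
From mathcomp Require Import zify ring lra.
Require Import Defs.
Import Order.TTheory GRing.Theory Num.Theory.
Set Implicit Arguments.
Unset Strict Implicit.
Unset Printing Implicit Defensive.
Local Open Scope ring_scope.

(** * Spectral radius and subsolutions *)

Section SpectralRadius.
Variables (R : realType) (n : nat) (A : 'M[R]_n).
Let AC : 'M[R[i]]_n := map_mx (real_complex R) A.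

(** Over the algebraically closed field [R[i]] the characteristic polynomial splits, so the
    eigenvalues form a finite list, non-empty as the degree is [n > 0]; the supremum of the moduli
    is therefore attained. *)
Lemma spectral_radius_max : (0 < n)%N ->
  exists2 z : R[i], eigenvalue AC z
    & spectral_radius A = ComplexField.Normc.normc z /\
      forall z', eigenvalue AC z' ->
        ComplexField.Normc.normc z' <= spectral_radius A.
Proof.
move=> n0; pose N := @ComplexField.Normc.normc R.
have [rs rsE] := closed_field_poly_normal (char_poly AC).
have eigE z : eigenvalue AC z = (z \in rs).
  rewrite eigenvalue_root_char rsE rootZ ?root_prod_XsubC //.
  by rewrite (monicP (char_poly_monic _)) oner_eq0.
have [z0 z0rs z0max] : exists2 z0, z0 \in rs & forall z, z \in rs -> N z <= N z0.
  have : rs != [::].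
    apply: contraTneq n0 => rs0; have := size_char_poly AC.
    by rewrite rsE rs0 big_nil (monicP (char_poly_monic _)) scale1r size_poly1 => -[<-].
  elim: (rs) => // z s IHs _; have [->|/IHs[z0 z0s z0max]] := eqVneq s [::].
    by exists z; rewrite ?mem_head // => z'; rewrite inE => /eqP->.
  have [le|/ltW le] := leP (N z) (N z0).
    by exists z0; [rewrite inE z0s orbT|move=> z'; rewrite inE => /predU1P[->|/z0max]].
  exists z; first exact: mem_head.
  by move=> z'; rewrite inE => /predU1P[->//|/z0max h]; apply: le_trans le.
set E : set R := fun r : R => exists2 z : R[i], eigenvalue AC z & r = N z.
have supE : spectral_radius A = sup E by [].
have ubE : ubound E (N z0) by move=> _ [z + ->]; rewrite eigE; apply: z0max.
have E0 : E (N z0) by exists z0; rewrite ?eigE.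
have sE : sup E = N z0.
  apply/eqP; rewrite eq_le ge_sup //=; last by exists (N z0).
  by apply: ub_le_sup => //; exists (N z0).
exists z0; rewrite ?eigE //; split; first by rewrite supE.
by move=> z'; rewrite eigE supE sE => /z0max.
Qed.

Lemma le_spectral_radius (x : 'rV[R]_n) (l : R) :
  x != 0 -> x *m A = l *: x -> l <= spectral_radius A.
Proof.
move=> x0 xA.
have n0 : (0 < n)%N by case: n x x0 {xA} => // x; rewrite thinmx0 eqxx.
have [z _ [_ zmax]] := spectral_radius_max n0.
apply: (@le_trans _ _ (ComplexField.Normc.normc (real_complex R l))).
  by rewrite /= expr0n addr0 sqrtr_sqr ler_norm.
apply: zmax; apply/eigenvalueP; exists (map_mx (real_complex R) x).
  by rewrite -map_mxM xA map_mxZ.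
by rewrite map_mx_eq0.
Qed.

End SpectralRadius.

(** [x] collects the moduli of the entries of an eigenvector whose eigenvalue has the largest
    modulus; the triangle inequality turns the eigenvalue equation into an inequality. *)
Lemma lambda1_subsolution (R : realType) (m : nat) (V : finType) (H : hypergraph V) :
  (2 <= m)%N -> (0 < #|V|)%N ->
  exists x : V -> R, [/\ forall v, 0 <= x v, exists v, x v != 0
    & forall v, (m%:R - 1) * lambda1 R m H * x v
        <= \sum_(e in edges H | v \in e) \sum_(u in e | u != v) x u].
Proof.
move=> m2 V0; have [z ez [zE _]] := spectral_radius_max (adjacency R m H) V0.
have /eigenvalueP[y yA y0] := ez.
pose x v := ComplexField.Normc.normc (y 0 (enum_rank v)).
have x_ge0 v : 0 <= x v by rewrite /x; case: (y _ _) => a b /=; apply: sqrtr_ge0.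
have M0 : 0 < m%:R - 1 :> R by rewrite subr_gt0 ltr1n.
exists x; split => //.
  have [i yi] : exists i, y 0 i != 0.
    apply/existsP; apply: contraNT y0; rewrite negb_exists => /forallP y0.
    by apply/eqP/rowP => i; rewrite mxE; apply/eqP; have := y0 i; rewrite negbK.
  exists (enum_val i); rewrite /x enum_valK.
  by apply: contra yi => /eqP/ComplexField.Normc.eq0_normc ->.
move=> v; have := congr1 (fun w : 'rV_#|V| => ComplexField.Normc.normc (w 0 (enum_rank v))) yA.
rewrite /lambda1 zE !mxE ComplexField.Normc.normcM -/(x v) => h.
rewrite -mulrA -h {h}.
pose adj u := (u != v) && [exists e in edges H, (u \in e) && (v \in e)].
have -> : \sum_j y 0 j * (map_mx (real_complex R) (adjacency R m H)) j (enum_rank v)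
   = \sum_u (if adj u then y 0 (enum_rank u) * real_complex R ((m%:R - 1)^-1) else 0).
  rewrite (reindex (@enum_rank V)) /=; last first.
    by exists enum_val => i _; rewrite ?enum_rankK ?enum_valK.
  apply: eq_bigr => u _; rewrite !mxE !enum_rankK (inj_eq enum_rank_inj) -/(adj u).
  by case: ifP; rewrite // mulr0.
rewrite -big_mkcond /=.
apply: (@le_trans _ _ ((m%:R - 1) * \sum_(u | adj u) x u * (m%:R - 1)^-1)).
  rewrite ler_pM2l //; elim/big_rec2: _ => [|u b c _ le].
    by rewrite ComplexField.Normc.normc0.
  apply: (le_trans (le_normcD _ _)).
  rewrite ComplexField.Normc.normcM lerD //.
  by rewrite [X in _ * X]/= expr0n addr0 sqrtr_sqr ger0_norm // invr_ge0 ltW.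
rewrite -mulr_suml mulrCA divff ?mulr1 ?gt_eqF //.
(* Grouped by [u], the right side counts [x u] once for each edge through [u] and [v], hence at
   least once when they are adjacent. *)
rewrite (exchange_big_dep (fun u => u != v)) /=; last by move=> ? ? _ /andP[].
rewrite [leLHS](_ : _ = \sum_(u | u != v) if adj u then x u else 0); last first.
  rewrite -big_mkcondr; apply: eq_bigl => u.
  by rewrite /adj andbA andbb.
apply: ler_sum => u uv; case: ifP => [/andP[_ /existsP[e /and3P[eH ue ve]]]|_].
  rewrite (bigD1 e) /=; last by rewrite eH ue ve uv.
  by rewrite lerDl sumr_ge0.
by rewrite sumr_ge0.
Qed.

(* [E] may be any family enumerating the edges, provided two vertices determine
   the index of an edge through both: then a vertex is adjacent to the rest of
   each of its edges exactly once. *)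
Lemma le_lambda1 (R : realType) (m : nat) (V J : finType) (H : hypergraph V)
    (E : J -> {set V}) (x : V -> R) (l : R) :
  (2 <= m)%N ->
  (forall e, (e \in edges H) = [exists j, e == E j]) ->
  (forall u v i j, u != v -> u \in E i -> v \in E i -> u \in E j -> v \in E j -> i = j) ->
  (exists v, x v != 0) ->
  (forall v, \sum_(j | v \in E j) (\sum_(u in E j) x u - x v)
     = (m%:R - 1) * l * x v) ->
  l <= lambda1 R m H.
Proof.
move=> m2 HE Elin [v0 xv0] xE.
have M0 : 0 < m%:R - 1 :> R by rewrite subr_gt0 ltr1n.
apply: (@le_spectral_radius _ _ _ (\row_i x (enum_val i))).
  apply: contra xv0 => /eqP/rowP/(_ (enum_rank v0)); rewrite !mxE enum_rankK.
  by move->.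
apply/rowP => i; rewrite !mxE; set v := enum_val i.
have -> : l * x v = (m%:R - 1)^-1 * ((m%:R - 1) * l * x v).
  by rewrite !mulrA mulVf ?mul1r // gt_eqF.
rewrite -xE mulr_sumr (reindex (@enum_rank V)) /=; last first.
  by exists enum_val => j _; rewrite ?enum_rankK ?enum_valK.
have -> : \sum_(j | v \in E j) (m%:R - 1)^-1 * (\sum_(u in E j) x u - x v)
  = \sum_(j | v \in E j) \sum_(u in E j | u != v) (m%:R - 1)^-1 * x u.
  apply: eq_bigr => j vj; rewrite -mulr_sumr; congr (_ * _).
  by rewrite (bigD1 v) //= addrAC subrr add0r.
rewrite (exchange_big_dep (fun u => u != v)) /=; last by move=> ? ? _ /andP[].
rewrite [RHS]big_mkcond; apply: eq_bigr => u _; rewrite !mxE !enum_rankK.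
have -> : (enum_rank u != i) = (u != v) by rewrite -(inj_eq enum_rank_inj) enum_valK.
case: eqVneq => [//|uv] /=; first by rewrite mulr0.
case: ifP => [/existsP[e]|/negbT].
  rewrite HE => /and3P[/existsP[j /eqP ->] uj vj].
  rewrite (big_pred1 j) /=; first by rewrite mulrC.
  move=> j' /=; rewrite andbT; apply/andP/eqP => [[vj' uj']|->//].
  exact: Elin uv uj' vj' uj vj.
rewrite negb_exists => /forallP nE; rewrite mulr0 big1 // => j /and3P[vj uj _].
by have := nE (E j); rewrite HE uj vj !andbT => /existsP[]; exists j.
Qed.

(** * The transfer map *)

Section Transfer.
Variables (R : realFieldType) (M s : R).

(** In an edge with end weights [z] and [y], the [M - 1] other vertices, if pendant, have total
    weight at most [shift * (z + y)] in a subsolution. Eliminating them and then [y] yields the two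
    terms of [transfer], whose pole lies at [s - shift]. *)
Definition shift : R := (M - 1) / (s - M + 2).
Definition transfer (G : R) : R := shift + (1 + shift) ^+ 2 / (s - shift - G).
Definition leaf : R := M / (s - M + 1).
Definition ray (j : nat) : R := iter j transfer 0.

Hypotheses (M1 : 1 <= M) (sM : M - 1 < s).

(* [lra] ignores section hypotheses. *)
Ltac lraM := move: (M1) (sM) => ? ?; lra.

Lemma shift_ge0 : 0 <= shift.
Proof. by apply: divr_ge0; lraM. Qed.

Lemma leaf_gt0 : 0 < leaf.
Proof. by apply: divr_gt0; lraM. Qed.

Lemma s_shift : s + 1 = (1 + shift) * (s - M + 2).
Proof. by rewrite /shift; field; lraM. Qed.

Lemma M_shift : M - 1 = shift * (s - M + 2).
Proof. by rewrite /shift; field; lraM. Qed.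

Lemma pole_gt0 : 0 < s - shift.
Proof.
have -> : s - shift = (1 + shift) * (s - M + 1) by have := s_shift; lraM.
by apply: mulr_gt0; have := shift_ge0; lraM.
Qed.

(** This is [transfer 0 = leaf] cleared of denominators; the slope estimates below use it to express
    [(1 + shift) ^+ 2] through [leaf]. *)
Lemma sqr_shift : (1 + shift) ^+ 2 = (s - shift) * (leaf - shift).
Proof.
by rewrite /leaf /shift; field; lraM.
Qed.

Lemma transfer0 : transfer 0 = leaf.
Proof.
rewrite /transfer subr0 sqr_shift mulrC mulKf; first by ring.
by rewrite gt_eqF ?pole_gt0.
Qed.

Lemma shift_lt_leaf : shift < leaf.
Proof.
have := sqr_shift; have : 0 < (1 + shift) ^+ 2.
  by rewrite exprn_gt0 //; have := shift_ge0; lraM.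
by move=> + e; rewrite e pmulr_rgt0 ?pole_gt0 // subr_gt0.
Qed.

(** The difference quotient of a Moebius map: contraction amounts to the product of the two
    distances to the pole exceeding [(1 + shift) ^+ 2]. *)
Lemma transfer_sub (G H : R) : G < s - shift -> H < s - shift ->
  transfer G - transfer H
    = (1 + shift) ^+ 2 * (G - H) / ((s - shift - G) * (s - shift - H)).
Proof.
move=> hG hH; rewrite /transfer.
by set c := shift in hG hH *; field; apply/andP; split; lraM.
Qed.

Lemma transfer_lt (G H : R) : H < G -> G < s - shift -> transfer H < transfer G.
Proof.
move=> HG Gq; rewrite -subr_gt0 transfer_sub //; last exact: lt_trans Gq.
rewrite divr_gt0 // mulr_gt0 ?exprn_gt0 //; have := shift_ge0; lraM.
Qed.

Lemma transfer_le (G H : R) : H <= G -> G < s - shift -> transfer H <= transfer G.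
Proof. by rewrite le_eqVlt => /predU1P[->//|/transfer_lt h /h/ltW]. Qed.

(* [S] is the total weight of an edge minus a vertex of weight [z]: the other
   vertices are one vertex of weight [y] carrying further branches of total
   influence [G], and [M - 1] pendant vertices of total weight [Y]. *)
Lemma edge_le_transfer (G z y Y : R) : G < s - shift -> 
  (s + 1) * Y <= (M - 1) * (z + (y + Y)) ->
  (s + 1 - G) * y <= z + (y + Y) ->
  y + Y <= transfer G * z.
Proof.
move=> Gq; rewrite s_shift M_shift.
set c := shift in Gq *; set w := s - M + 2; move=> hY hy.
have c0 : 0 <= c := shift_ge0; have w1 : 1 < w by rewrite /w; lraM.
have {}hY : (1 + c) * Y <= c * (z + (y + Y)).
  rewrite -(@ler_pM2r _ w); last by lraM.
  by rewrite mulrAC [leRHS]mulrAC.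
have aE : (1 + c) * w = (s - c) + (1 + c) by rewrite -s_shift; ring.
rewrite aE in hy.
rewrite /transfer -/c -(@ler_pM2r _ (s - c - G)); last by lraM.
have -> : (c + (1 + c) ^+ 2 / (s - c - G)) * z * (s - c - G)
  = (c * (s - c - G) + (1 + c) ^+ 2) * z by field; lraM.
set t := s - c - G; have t0 : 0 < t by rewrite /t; lraM.
have {}hy : (t + (1 + c)) * y <= z + (y + Y) by move: hy; rewrite /t; congr (_ <= _); ring.
have h1 : (t + (1 + c)) * ((1 + c) * Y) <= (t + (1 + c)) * (c * (z + (y + Y))).
  by rewrite ler_pM2l //; lraM.
have h2 : (1 + c) * ((t + (1 + c)) * y) <= (1 + c) * (z + (y + Y)).
  by rewrite ler_pM2l //; lraM.
set X := z + (y + Y) in h1 h2.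
have h : (1 + c) * (t + (1 + c)) * (y + Y) <= (c * (t + (1 + c)) + (1 + c)) * X.
  have := lerD h1 h2; congr (_ <= _); ring.
rewrite -subr_ge0 in h; rewrite -subr_ge0; move: h; rewrite /X.
by congr (0 <= _); ring.
Qed.

End Transfer.

(** * Contraction of the transfer map and concavity of the ray *)

Lemma double_leS (k p j : nat) : (4 * p <= k -> j < 2 * p -> 2 * j.+1 <= k + 1)%N.
Proof. lia. Qed.

Section Ray.
Variables (R : realFieldType) (M s : R) (k p : nat).
Hypotheses (M1 : 1 <= M) (sM : M - 1 < s) (p1 : (0 < p)%N)
  (kp : 4 * p%:R ^+ 2 + 1 <= k%:R :> R).
(** At a solution of [s = (k - 2p) leaf + 2 ray p] this says that [ray p] is worth at least one
    leaf. *)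
Hypothesis Ns : (k%:R - 2 * p%:R + 2) * leaf M s <= s.

Let c := shift M s.
Let g := transfer M s.
Let g1 := leaf M s.
Let g1_gt0 : 0 < g1. Proof. exact: leaf_gt0. Qed.
Let c_ge0 : 0 <= c. Proof. exact: shift_ge0. Qed.
Let c_lt : c < g1. Proof. exact: shift_lt_leaf. Qed.
Let b_eq : (1 + c) ^+ 2 = (s - c) * (g1 - c). Proof. exact: sqr_shift. Qed.

Let p1R : 1 <= p%:R :> R. Proof. by rewrite ler1n. Qed.
Let kp4 : (4 * p <= k)%N.
Proof. by rewrite -(ler_nat R) natrM; move: (kp) (p1R) => ? ?; nra. Qed.

(** With N = k - 2p + 2, [s] is worth at least N leaves, of which a branch of n edges takes at most
    n; this estimates what remains. *)
Let Nn_ge (n : nat) : (2 * n <= k + 1)%N ->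
  2 * p%:R ^+ 2 - 2 * p%:R + 2 <= (k%:R + 3) / 2 - 2 * p%:R :> R /\
  (k%:R + 3) / 2 - 2 * p%:R <= k%:R - 2 * p%:R + 2 - n%:R :> R.
Proof.
rewrite -(ler_nat R) natrM natrD => h; move: (kp) => ?; split; lra.
Qed.

Lemma below_pole (n : nat) (G : R) : (2 * n <= k + 1)%N -> G <= (n%:R - 1) * g1 ->
  (k%:R - 2 * p%:R + 2 - n%:R) * g1 < s - c - G.
Proof.
by move=> hn hG; move: (Ns) (c_lt) (hG); rewrite -/g1 !mulrBl; lra.
Qed.

(** Write q = s - c = (N - 1) g1 + t with t > 0. The distances of G and H to the pole are at least
    (N - n) g1 + t and (N - j) g1 + t, while [(1 + c) ^+ 2] is at most q g1. The coefficients of the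
    product, as a polynomial in t, dominate those of q g1, and t^2 is left over. *)
Lemma transfer_slope (n j : nat) (G H : R) : (2 * n <= k + 1)%N -> (j < 2 * p)%N ->
  G <= (n%:R - 1) * g1 -> H <= (j%:R - 1) * g1 ->
  [/\ 0 < s - c - G, 0 < s - c - H & (1 + c) ^+ 2 < (s - c - G) * (s - c - H)].
Proof.
move=> hn hj hG hH; have [X2 hX] := Nn_ge hn.
have hjk : (2 * j <= k + 1)%N.
  exact: leq_trans (leq_mul (leqnn 2) (leqnSn j)) (double_leS kp4 hj).
have G1 := below_pole hn hG; have H1 := below_pole hjk hH.
have hjR : j%:R + 1 <= 2 * p%:R :> R by rewrite natr1 -natrM ler_nat.
move: (p1R) => pR.
set X := (k%:R + 3) / 2 - 2 * p%:R in X2 hX.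
have Xp : p%:R + 1 <= X by nra.
have NjX : 2 * X <= k%:R - 2 * p%:R + 2 - j%:R by rewrite /X; lra.
have NX : k%:R - 2 * p%:R + 2 - 1 = 2 * X + 2 * p%:R - 2 by rewrite /X; field.
set N := k%:R - 2 * p%:R + 2 in G1 H1 hX NjX NX.
(* As j <= 2p - 1, the factors are at least X and 2X, whereas N - 1 = 2X + 2p - 2; then X >= p + 1
   is enough. *)
have cross : N - 1 <= (N - n%:R) * (N - j%:R).
  apply: (@le_trans _ _ (X * (2 * X))); first by rewrite NX; nra.
  by apply: ler_pM => //; lra.
have Ng : 0 < (N - n%:R) * g1 by apply: mulr_gt0 => //; lra.
have Nj : 0 < (N - j%:R) * g1 by apply: mulr_gt0 => //; lra.
split; [exact: lt_trans G1|exact: lt_trans H1|].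
rewrite b_eq; set q := s - c in G1 H1 *.
have hq : (N - 1) * g1 < q.
  by move: (Ns) (c_lt); rewrite -/g1 -/N /q mulrBl; lra.
pose t := q - (N - 1) * g1; have t0 : 0 < t by rewrite /t; lra.
have qE : q = (N - 1) * g1 + t by rewrite /t; ring.
apply: (@le_lt_trans _ _ (q * g1)).
  rewrite ler_pM2l; first by move: (c_ge0) => ?; lra.
  have N1 : 0 < N - 1 by rewrite NX; lra.
  by rewrite qE; apply: addr_gt0 => //; apply: mulr_gt0.
apply: (@lt_le_trans _ _ (((N - n%:R) * g1 + t) * ((N - j%:R) * g1 + t))); last first.
  apply: ler_pM; [lra|lra| |].
    by move: hG; rewrite qE !mulrBl; lra.
  by move: hH; rewrite qE !mulrBl; lra.
have -> : ((N - n%:R) * g1 + t) * ((N - j%:R) * g1 + t) =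
   (N - n%:R) * (N - j%:R) * g1 ^+ 2 + t * ((2 * N - n%:R - j%:R) * g1) + t ^+ 2 by ring.
have -> : q * g1 = (N - 1) * g1 ^+ 2 + t * g1 by rewrite qE; ring.
have : (N - 1) * g1 ^+ 2 <= (N - n%:R) * (N - j%:R) * g1 ^+ 2.
  by rewrite ler_wpM2r // sqr_ge0.
have : t * g1 <= t * ((2 * N - n%:R - j%:R) * g1).
  by rewrite ler_pM2l // ler_peMl ?ltW //; lra.
have : 0 < t ^+ 2 by rewrite exprn_gt0.
lra.
Qed.

Lemma transfer_contract (n j : nat) (G H : R) : (2 * n <= k + 1)%N -> (j < 2 * p)%N ->
  G <= (n%:R - 1) * g1 -> H <= (j%:R - 1) * g1 -> H < G ->
  g G - g H < G - H.
Proof.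
move=> hn hj hG hH HG; have [G0 H0 sl] := transfer_slope hn hj hG hH.
rewrite transfer_sub //; [|by rewrite -subr_gt0..].
by rewrite ltr_pdivrMr ?mulr_gt0 // mulrC ltr_pM2l // subr_gt0.
Qed.

(** Contraction between [ray j] and 0 gives [ray (j + 1) - leaf < ray j] for positive [ray j], so
    each edge adds at most one leaf. *)
Lemma ray_bounds (j : nat) : (j <= 2 * p)%N -> 0 <= ray M s j <= j%:R * g1.
Proof.
elim: j => [|j IHj] hj; first by rewrite mul0r lexx.
have /andP[r0 rj] := IHj (ltnW hj).
have jk : (2 * j.+1 <= k + 1)%N := double_leS kp4 hj.
rewrite [ray M s _]/=.
have r1 : ray M s j <= (j.+1%:R - 1) * g1 by rewrite -natr1 addrK.
have h01 : 0 <= (1%:R - 1) * g1 by rewrite subrr mul0r.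
have hp : (1 < 2 * p)%N by rewrite (@leq_mul 2 1).
have [G0 H0 _] := transfer_slope jk hp r1 h01.
have le0 : leaf M s <= transfer M s (ray M s j).
  by rewrite -[leaf M s]transfer0 //; apply: transfer_le => //; move: G0; rewrite /c; lra.
apply/andP; split; first by apply: le_trans le0; apply: ltW.
move: r0; rewrite le_eqVlt => /predU1P[r0|r0].
  by rewrite -r0 transfer0 // -/g1; apply: ler_peMl; [exact: ltW|rewrite ler1n].
have := transfer_contract jk hp r1 h01 r0.
rewrite /g transfer0 // -/g1 => h.
by rewrite -natr1 mulrDl mul1r; move: h rj; lra.
Qed.

Lemma ray_below_pole (j : nat) : (j < 2 * p)%N -> ray M s j < s - c.
Proof.
move=> hj; have /andP[_ rj] := ray_bounds (ltnW hj).
have h0 : ray M s j <= (j.+1%:R - 1) * g1 by rewrite -natr1 addrK.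
have jk : (2 * j.+1 <= k + 1)%N := double_leS kp4 hj.
have [X2 hX] := Nn_ge jk.
have h := below_pole jk h0; rewrite -subr_gt0; apply: le_lt_trans h.
by apply: mulr_ge0; [move: (p1R) => ?; nra|exact: ltW].
Qed.

Lemma ray_lt (j : nat) : (j < 2 * p)%N -> ray M s j < ray M s j.+1.
Proof.
elim: j => [|j IHj] hj; first by rewrite /= transfer0.
by apply: transfer_lt => //; [exact/IHj/ltnW|exact: (ray_below_pole hj)].
Qed.

Lemma leaf_le_ray (j : nat) : (0 < j <= 2 * p)%N -> g1 <= ray M s j.
Proof.
case: j => // j; elim: j => [|j IHj] hj; first by rewrite /= transfer0.
by apply: (le_trans (IHj (ltnW hj))); apply/ltW/(ray_lt hj).
Qed.

(** Contraction applied to two consecutive iterates. *)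
Lemma ray_concave (j : nat) : (j.+1 < 2 * p)%N ->
  ray M s j.+2 - ray M s j.+1 < ray M s j.+1 - ray M s j.
Proof.
move=> hj; apply: (@transfer_contract j.+2 j.+1); [exact: double_leS kp4 hj|exact: hj| | |].
- have /andP[_] := ray_bounds (ltnW hj).
  by rewrite -[j.+2%:R]natr1 addrK.
- have /andP[_] := ray_bounds (ltnW (ltnW hj)).
  by rewrite -[j.+1%:R]natr1 addrK.
- exact/ray_lt/ltnW.
Qed.

Lemma ray_increment_lt (i j : nat) : (i < j < 2 * p)%N ->
  ray M s j.+1 - ray M s j < ray M s i.+1 - ray M s i.
Proof.
move=> /andP[ij jp]; elim: j ij jp => // j IHj; rewrite ltnS leq_eqVlt.
case/predU1P=> [->|ij] jp; first exact: ray_concave.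
by apply: lt_trans (IHj ij (ltnW jp)); apply: ray_concave.
Qed.

(** Increments of the ray decrease strictly, so moving an edge from the longer ray to the shorter
    one raises the sum until both have length p. *)
Lemma ray_pair_le (a b : nat) : (a + b = 2 * p)%N ->
  ray M s a + ray M s b <= 2 * ray M s p ?= iff (a == p).
Proof.
suff main t : (t < p)%N ->
    ray M s (p + t.+1) + ray M s (p - t.+1) < 2 * ray M s p.
  move=> ab; case: (ltngtP a p) => h.
  - have := main (p - a.+1)%N _.
    have -> : (p + (p - a.+1).+1 = b)%N by lia.
    have -> : (p - (p - a.+1).+1 = a)%N by lia.
    by move=> hh; apply/leifP; rewrite addrC hh //; lia.
  - have := main (a - p.+1)%N _.
    have -> : (p + (a - p.+1).+1 = a)%N by lia.
    have -> : (p - (a - p.+1).+1 = b)%N by lia.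
    by move=> hh; apply/leifP; rewrite hh //; lia.
  - have bp : b = p by lia.
    by rewrite h bp; apply/leifP/eqP; ring.
elim: t => [|t IHt] tp.
  have := @ray_increment_lt p.-1 p; rewrite prednK // addn1 subn1.
  by move=> h; have := h ltac:(lia); lra.
have := IHt (ltnW tp).
have := @ray_increment_lt (p - t.+2) (p + t.+1).
have -> : ((p - t.+2).+1 = p - t.+1)%N by lia.
by rewrite -addnS => h; have := h ltac:(lia); lra.
Qed.

(** Meant for a branch that contains a whole diametral path. Here [transfer G = leaf + (leaf - c) G
    / (s - c - G)], and the denominator is more than N - n leaves, which reduces the claim to an
    inequality between numbers of edges. *)
Lemma transfer_far (n : nat) : (2 * p <= n)%N -> (2 * n <= k + 1)%N ->
  g ((n%:R - 1) * g1) < (n%:R - 2 * p%:R + 2) * g1.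
Proof.
move=> pn hn; have [X2 hX] := Nn_ge hn.
have := below_pole hn (lexx _).
have pnR : 2 * p%:R <= n%:R :> R by rewrite -natrM ler_nat.
move: (p1R) => pR; move: X2 hX.
set N := k%:R - 2 * p%:R + 2.
have -> : (k%:R + 3) / 2 - 2 * p%:R = (N + 1) / 2 - p%:R by rewrite /N; field.
move=> X2 hX G1; pose G := (n%:R - 1) * g1; rewrite -/G in G1 *.
have G0 : 0 <= G by rewrite mulr_ge0 ?ltW //; lra.
have N0 : 0 < N - n%:R by nra.
have t0 : 0 < s - c - G by apply: lt_trans G1; rewrite mulr_gt0.
have -> : g G = leaf M s + (g G - g 0) by rewrite /g transfer0 //; ring.
rewrite transfer_sub //; [|move: t0; rewrite /c; lra|move: t0 G0; rewrite /c; lra].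
rewrite -/c !subr0 b_eq.
have q0 : 0 < s - c by lra.
have -> : (s - c) * (g1 - c) * G / ((s - c - G) * (s - c)) = (g1 - c) * G / (s - c - G).
  by field; lra.
rewrite -/g1.
suff : (g1 - c) * G / (s - c - G) < (n%:R - 2 * p%:R + 1) * g1 by lra.
rewrite ltr_pdivrMr //.
(* With y = n - 2p + 1 and X = (N + 1)/2 - p this reads y + 2p - 2 <= y (2X - y), where 1 <= y <= X
   and p + 1 <= X. *)
have nat_ineq : n%:R - 1 <= (n%:R - 2 * p%:R + 1) * (N - n%:R).
  set y := n%:R - 2 * p%:R + 1; pose X := (N + 1) / 2 - p%:R.
  have -> : N - n%:R = 2 * X - y by rewrite /X /y; field.
  have -> : n%:R - 1 = y + 2 * p%:R - 2 by rewrite /y; ring.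
  have y1 : 1 <= y by rewrite /y; lra.
  have yX : y <= X by rewrite /y /X; lra.
  have Xp : p%:R + 1 <= X by rewrite /X; nra.
  nra.
apply: (@le_lt_trans _ _ (g1 * G)).
  by rewrite ler_wpM2r //; move: (c_ge0) => ?; lra.
apply: (@le_lt_trans _ _ ((n%:R - 2 * p%:R + 1) * ((N - n%:R) * g1) * g1)).
  by rewrite mulrC ler_pM2r // /G [leRHS]mulrA ler_pM2r.
by rewrite mulrAC ltr_pM2l // mulr_gt0 //; lra.
Qed.

End Ray.

(** * Solving the central equation *)

Section RayPoly.
Variables (R : realFieldType) (M : R).

(* Numerator and denominator of [ray M s j] as polynomials in [s]; they bring the
   equation for [s] within reach of [poly_ivt]. *)
Fixpoint ray_poly (j : nat) : {poly R} * {poly R} :=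
  if j is j'.+1 then
    let: (P, Q) := ray_poly j' in
    (M%:P * ('X + 1) * Q - (M - 1)%:P * P,
     ('X - M%:P + 1) * ('X + 1) * Q - ('X - (M - 2)%:P) * P)
  else (0, 1).

(** Each new denominator is the old one times [s - M + 2] and times the distance of the current ray
    value to the pole, so it stays positive as long as the iterates remain below the pole. *)
Lemma ray_polyE (s : R) (j : nat) : 1 <= M -> M - 1 < s ->
  (forall i, (i < j)%N -> ray M s i < s - shift M s) ->
  0 < (ray_poly j).2.[s] /\ (ray_poly j).1.[s] = ray M s j * (ray_poly j).2.[s].
Proof.
move=> M1 sM; elim: j => [|j IHj] hq; first by rewrite /ray /= !hornerE ltr01.
have [Q0 PE] := IHj (fun i ij => hq i (ltnW ij)); have rq := hq j (ltnSn j).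
rewrite [ray M s j.+1]/= -/(ray M s j) /=.
case: (ray_poly j) Q0 PE => P Q /= Q0 PE; rewrite !hornerE PE.
set x := ray M s j in rq PE *; set q := Q.[s] in Q0 *.
have w1 : 1 < s - M + 2 by lra.
have sE := s_shift M1 sM; have ME := M_shift M1 sM.
rewrite /transfer; set c := shift M s in rq sE ME *; set w := s - M + 2 in w1 sE ME.
have c0 : 0 <= c by apply: shift_ge0.
have den : (s - M + 1) * (s + 1) * q - (s - (M - 2)) * (x * q) = w * (s - c - x) * q.
  have -> : s - M + 1 = w - 1 by rewrite /w; ring.
  have -> : s - (M - 2) = w by rewrite /w; ring.
  have -> : s = (1 + c) * w - 1 by lra.
  ring.
have t0 : 0 < s - c - x by lra.
split.
  by rewrite den !mulr_gt0 //; lra.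
rewrite den.
have -> : (c + (1 + c) ^+ 2 / (s - c - x)) * (w * (s - c - x) * q)
   = (c * (s - c - x) + (1 + c) ^+ 2) * w * q by field; lra.
have -> : M = c * w + 1 by lra.
have -> : s = (1 + c) * w - 1 by lra.
ring.
Qed.

End RayPoly.

(** Since [M >= 1], the hypothesis gives 4k >= 16p^2 + 1, and integrality of k raises this to k >=
    4p^2 + 1. *)
Lemma lt_of_diameter_bound (R : realFieldType) (M : R) (k p : nat) : 1 <= M ->
  ((4 * (2 * p)%:R ^+ 2 - 1) * M + 2) / 4 <= k%:R -> (0 < p)%N ->
  4 * p%:R ^+ 2 + 1 <= k%:R :> R.
Proof.
move=> M1 hk p0; rewrite natrM in hk.
have p1 : 1 <= p%:R :> R by rewrite ler1n.
have : (16 * p ^ 2 + 1)%N%:R <= (4 * k)%N%:R :> R.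
  have : 0 <= (4 * (2 * p%:R) ^+ 2 - 1) * (M - 1) :> R by apply: mulr_ge0; nra.
  by rewrite natrD !natrM; lra.
rewrite ler_nat -natrX -natrM natr1 ler_nat; lia.
Qed.

(** Intermediate value theorem between [lo], where replacing each ray by one leaf makes the equation
    exact, and [hi], which is M times the bound of (ii). The difference of the two sides changes
    sign because [ray p] lies between one leaf and p leaves. *)
Lemma exists_center_solution (R : rcfType) (M : R) (k p : nat) : 1 <= M -> (0 < p)%N ->
  ((4 * (2 * p)%:R ^+ 2 - 1) * M + 2) / 4 <= k%:R ->
  exists s, [/\ M - 1 < s, (k%:R - 2 * p%:R + 2) * leaf M s <= s,
     s = (k%:R - 2 * p%:R) * leaf M s + 2 * ray M s p
   & s < (M + Num.sqrt (M ^+ 2 + 4 * (k%:R - 2 * p%:R) * M)) / 2].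
Proof.
move=> M1 p0 hk; have kp := lt_of_diameter_bound M1 hk p0.
have p1 : 1 <= p%:R :> R by rewrite ler1n.
rewrite natrM in hk; set K := k%:R - 2 * p%:R.
have K0 : 1 <= K by rewrite /K; nra.
pose D := M ^+ 2 + 4 * K * M; have D0 : 0 <= D by rewrite /D; nra.
pose hi := (M + Num.sqrt D) / 2; rewrite -/hi.
have hiE : hi * (hi - M) = M * K.
  have := sqr_sqrtr D0; rewrite /hi; set r := Num.sqrt D => rE.
  have -> : (M + r) / 2 * ((M + r) / 2 - M) = (r ^+ 2 - M ^+ 2) / 4 by field.
  by rewrite rE /D; field.
(* The bound of (ii) exceeds d. The hypothesis on k enters here in full: it makes
   [M * K = hi * (hi - M)] larger than the value of this quadratic at 2pM. *)
have M_hi : 2 * p%:R * M < hi.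
  have r0 := sqrtr_ge0 D.
  have hiM : M <= hi.
    rewrite /hi; suff : M <= Num.sqrt D by lra.
    rewrite -[leLHS]ger0_norm -?sqrtr_sqr; last lra.
    by apply: ler_wsqrtr; rewrite /D; nra.
  rewrite ltNge; apply/negP => h.
  have : hi * (hi - M) <= 2 * p%:R * M * (2 * p%:R * M - M) by apply: ler_pM; lra.
  by rewrite hiE /K; nra.
pose E := (M - 1) ^+ 2 + 4 * (K + 2) * M; have E0 : 0 <= E by rewrite /E; nra.
pose lo := (M - 1 + Num.sqrt E) / 2.
have loE : lo * (lo - M + 1) = M * (K + 2).
  have := sqr_sqrtr E0; rewrite /lo; set r := Num.sqrt E => rE.
  have -> : (M - 1 + r) / 2 * ((M - 1 + r) / 2 - M + 1) = (r ^+ 2 - (M - 1) ^+ 2) / 4 by field.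
  by rewrite rE /E; field.
have lo_M : M - 1 < lo.
  rewrite /lo; suff : M - 1 < Num.sqrt E by lra.
  rewrite -[ltLHS]ger0_norm -?sqrtr_sqr; last lra.
  by rewrite ltr_sqrt /E; nra.
have lo_hi : lo < hi.
  have hiE' : hi * (hi - M + 1) = M * K + hi by rewrite -hiE; ring.
  rewrite ltNge; apply/negP => h.
  have : hi * (hi - M + 1) <= lo * (lo - M + 1) by apply: ler_pM; nra.
  by rewrite hiE' loE; nra.
(* To the right of [lo] the standing assumptions of the ray estimates hold, so all the denominators
   involved are positive. *)
have good s : lo <= s -> M - 1 < s /\ (K + 2) * leaf M s <= s.
  move=> los; have sM : M - 1 < s by exact: lt_le_trans los.
  split=> //; rewrite /leaf mulrA ler_pdivrMr; last lra.
  by rewrite mulrC -loE; apply: ler_pM; lra.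
have polyE s : lo <= s -> 0 < (ray_poly M p).2.[s] /\
    (ray_poly M p).1.[s] = ray M s p * (ray_poly M p).2.[s].
  move=> /good[sM Ns]; apply: ray_polyE => // i ip.
  by apply: (ray_below_pole M1 sM p0 kp Ns); apply: leq_trans ip (leq_pmull _ _).
(* The central equation, multiplied by [s - M + 1] and by the denominator of [ray p]. *)
pose Phi : {poly R} := ('X * ('X - M%:P + 1) - (K * M)%:P) * (ray_poly M p).2
  - ('X - M%:P + 1) * ((ray_poly M p).1 + (ray_poly M p).1).
have PhiE s : lo <= s -> Phi.[s] =
    (s - M + 1) * (ray_poly M p).2.[s] * (s - (K * leaf M s + 2 * ray M s p)).
  move=> los; have [_ PE] := polyE s los; have [sM _] := good s los.
  have -> : Phi.[s] = (s * (s - M + 1) - K * M) * (ray_poly M p).2.[s]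
      - (s - M + 1) * (2 * (ray_poly M p).1.[s]) 
    by rewrite /Phi !(hornerD, hornerN, hornerM, hornerX, hornerC); ring.
  by rewrite PE /leaf; field; lra.
have Phi_lo : Phi.[lo] <= 0.
  have [sM Ns] := good lo (lexx _); have [Q0 _] := polyE lo (lexx _).
  rewrite PhiE // pmulr_rle0; last by apply: mulr_gt0 => //; lra.
  have := leaf_le_ray M1 sM p0 kp Ns (j := p); rewrite p0 leq_pmull // => /(_ isT).
  suff : lo = (K + 2) * leaf M lo by lra.
  by rewrite /leaf mulrA [_ * M]mulrC -loE; field; lra.
have Phi_hi : 0 < Phi.[hi].
  have [sM Ns] := good hi (ltW lo_hi); have [Q0 _] := polyE hi (ltW lo_hi).
  rewrite PhiE ?ltW // pmulr_rgt0; last by apply: mulr_gt0 => //; lra.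
  have := ray_bounds M1 sM p0 kp Ns (j := p); rewrite leq_pmull // => /(_ isT)/andP[_].
  (* K leaves fall short of [hi] by [hi / M] leaves, and these outweigh the at most 2p leaves of the
     two rays. *)
  have -> : K * leaf M hi = hi - leaf M hi * (hi / M).
    have -> : hi - leaf M hi * (hi / M) = hi * (hi - M) / (hi - M + 1).
      by rewrite /leaf; field; lra.
    by rewrite hiE /leaf; field; lra.
  have l0 : 0 < leaf M hi by apply: leaf_gt0.
  have hM : 2 * p%:R < hi / M by rewrite ltr_pdivlMr //; lra.
  by nra.
have [|s /andP[los]] := @poly_ivt _ Phi _ _ (ltW lo_hi); first by rewrite Phi_lo ltW.
rewrite le_eqVlt => /predU1P[->|shi]; rewrite rootE; first by rewrite gt_eqF.
have [sM Ns] := good s los; have [Q0 _] := polyE s los.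
rewrite PhiE // mulf_eq0 subr_eq0 gt_eqF /=; last by apply: mulr_gt0 => //; lra.
by move=> /eqP sE; exists s.
Qed.

(** * Branches *)

Section Branch.
Variables (V : finType) (H : hypergraph V).
Implicit Types (v w x : V) (e f g : {set V}).

Definition meet_off w : rel {set V} := fun e f =>
  [&& e \in edges H, f \in edges H & [exists v, [&& v != w, v \in e & v \in f]]].

(** For an edge [e] through [w], the part of the hypertree that is entered from [w] by [e]. *)
Definition branch w e : {set {set V}} := [set f | connect (meet_off w) e f].

Lemma meet_offP w e f : reflect
  [/\ e \in edges H, f \in edges H & exists v, [/\ v != w, v \in e & v \in f]]
  (meet_off w e f).
Proof.
apply: (iffP and3P) => -[-> ->].
  by move=> /existsP[v /and3P[]]; split=> //; exists v.
by case=> v [vw ve vf]; split=> //; apply/existsP; exists v; apply/and3P.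
Qed.

Lemma meet_off_sym w : connect_sym (meet_off w).
Proof.
apply: sym_connect_sym => e f.
by apply/meet_offP/meet_offP=> -[eH fH [v [vw ve vf]]]; split=> //; exists v.
Qed.

Lemma branch_refl w e : e \in branch w e.
Proof. by rewrite inE. Qed.

Lemma branch_sym w e f : (f \in branch w e) = (e \in branch w f).
Proof. by rewrite !inE meet_off_sym. Qed.

Lemma branch_trans w e f g : f \in branch w e -> g \in branch w f -> g \in branch w e.
Proof. by rewrite !inE; apply: connect_trans. Qed.

Lemma branch_step w e f g x : f \in branch w e -> f \in edges H -> g \in edges H ->
  x != w -> x \in f -> x \in g -> g \in branch w e.
Proof.
rewrite !inE => ef fH gH xw xf xg; apply: connect_trans ef (connect1 _).
by apply/meet_offP; split=> //; exists x.
Qed.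

Lemma branch_ind w e (P : {set V} -> Prop) : e \in edges H -> P e ->
  (forall f g x, f \in edges H -> g \in edges H -> x != w -> x \in f -> x \in g ->
     P f -> P g) ->
  forall f, f \in branch w e -> P f.
Proof.
move=> eH Pe Pstep f; rewrite inE => /connectP[s + ->].
elim: s e eH Pe => //= g s IHs e eH Pe /andP[/meet_offP[_ gH [x [xw xe xg]]] sp].
by apply: IHs sp => //; apply: (Pstep e g x).
Qed.

Lemma branch_edges w e f : e \in edges H -> f \in branch w e -> f \in edges H.
Proof. by move=> eH; move: f; apply: (branch_ind eH). Qed.

Hypothesis Hlin : linear_hypergraph H.
Hypothesis Hacyc : forall l (c : 'I_l -> V) (d : 'I_l -> {set V}), ~ loose_cycle H c d.

Lemma linear_eq e f x y : e \in edges H -> f \in edges H -> x != y ->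
  x \in e -> y \in e -> x \in f -> y \in f -> e = f.
Proof.
move=> eH fH xy xe ye xf yf; apply: contraTeq isT => ef.
have := Hlin eH fH ef; rewrite leqNgt => /negP[].
by apply/card_gt1P; exists x, y; rewrite !inE xe ye xf yf.
Qed.

(** A closed walk of edges based at [w]. Repetitions are allowed, which keeps the notion stable
    under shortening. *)
Definition closed_chain n w (e : nat -> {set V}) : Prop :=
  [/\ forall i, (i <= n)%N -> e i \in edges H,
      forall i, (i < n)%N -> exists x, [/\ x != w, x \in e i & x \in e i.+1],
      w \in e 0%N, w \in e n & e 0%N != e n].

(** Drops the t edges after position i. If these form the tail of the chain, [e i] takes over the
    role of [e n]. *)
Lemma closed_chain_shortcut n w (e : nat -> {set V}) i t : closed_chain n w e ->
  (i + t <= n)%N ->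
  ((i + t < n)%N -> exists x, [/\ x != w, x \in e i & x \in e (i + t).+1]) ->
  ((i + t)%N = n -> e i = e n) ->
  closed_chain (n - t) w (fun k => if (k <= i)%N then e k else e (k + t)%N).
Proof.
move=> [eE emeet w0 wn ne] itn hlt heq.
have lastE : (if (n - t <= i)%N then e (n - t)%N else e (n - t + t)%N) = e n.
  case: leqP => h; last by rewrite subnK //; lia.
  have nti : (n - t = i)%N by lia.
  by rewrite nti; apply: heq; lia.
split; rewrite ?lastE //.
- by move=> k kn; case: leqP => h; apply: eE; lia.
- move=> k kn; case: (ltngtP k i) => h; [by apply: emeet; lia| |].
    by rewrite addSn; apply: emeet; lia.
  by rewrite h addSn; apply: hlt; lia.
Qed.

(* A shortest closed chain is a loose cycle. *)
Lemma no_closed_chain n w (e : nat -> {set V}) : ~ closed_chain n w e.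
Proof.
elim/ltn_ind: n w e => n IHn w e ch; have [eE emeet w0 wn ne] := ch.
have chord i j x : (i.+1 < j <= n)%N -> x != w -> x \in e i -> x \in e j -> False.
  move=> /andP[ij jn] xw xi xj.
  have /IHn : (n - (j - i.+1) < n)%N by lia.
  apply; apply: (closed_chain_shortcut (i := i) ch); [lia| |lia].
  by move=> _; exists x; rewrite (_ : (i + (j - i.+1)).+1 = j) //; lia.
have einj i j : (i < j <= n)%N -> e i <> e j.
  move=> /andP[ij jn] eij; have /IHn : (n - (j - i) < n)%N by lia.
  apply; apply: (closed_chain_shortcut (i := i) ch); rewrite subnKC ?(ltnW ij) //.
    by rewrite eij; apply: emeet.
  by move=> <-.
have n2 : (1 < n)%N.
  case: n {IHn chord einj ch} eE emeet wn ne => [|[|//]] eE emeet wn ne.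
    by rewrite eqxx in ne.
  have [x [xw x0 x1]] := emeet 0%N isT.
  by case/eqP: ne; apply: (linear_eq (eE 0%N isT) (eE 1%N isT) xw).
(* An inner edge through [w] closes a shorter chain: the initial part if it differs from [e 0], and
   otherwise the final part. *)
have inner i : (0 < i < n)%N -> w \notin e i.
  move=> /andP[i0 in_]; apply/negP => wi.
  have [ei|ei] := eqVneq (e i) (e 0%N).
    apply: (IHn (n - i)%N _ w (fun k => e (k + i)%N)); first lia.
    split; rewrite ?subnK ?add0n ?ei ?(ltnW in_) //.
      by move=> k kn; apply: eE; lia.
    by move=> k kn; rewrite addSn; apply: emeet; lia.
  apply: (IHn i in_ w e); split=> //.
  - by move=> k ki; apply: eE; lia.
  - by move=> k ki; apply: emeet; lia.
  - by rewrite eq_sym.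
(* The vertices of the cycle are [w], between the last edge and the first, and [y i] between
   [e (i - 1)] and [e i]. *)
pose y i := odflt w [pick x | [&& x != w, x \in e i.-1 & x \in e i]].
have yP i : (0 < i <= n)%N -> [/\ y i != w, y i \in e i.-1 & y i \in e i].
  case: i => // i /= /emeet[x [xw xi xj]]; rewrite /y /=.
  by case: pickP => [z /and3P[] //|/(_ x)]; rewrite xw xi xj.
pose v (i : 'I_n.+1) := if i == ord0 then w else y i.
pose E (i : 'I_n.+1) := e i.
have Einj : injective E.
  move=> i j Eij; apply/val_inj; case: (ltngtP i j) => // h; exfalso.
    by apply: (einj i j) => //; rewrite h -ltnS ltn_ord.
  by apply: (einj j i) => //; rewrite h -ltnS ltn_ord.
have EH i : E i \in edges H by apply: eE; rewrite -ltnS.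
have predE (i : 'I_n.+1) : ord_pred i = (if i == ord0 then n else i.-1) :> nat.
  case: i => -[|i] hi /=; first by rewrite modn_small.
  by rewrite modnDr modn_small // ltnW.
have v_pred i : v i \in E (ord_pred i).
  rewrite /v /E predE; case: eqP => // i0; case: (yP i) => //.
  by rewrite lt0n -ltnS ltn_ord andbT; apply/eqP => ?; apply/i0/val_inj.
have v_in i : v i \in E i.
  rewrite /v /E; case: eqP => [->//|i0]; case: (yP i) => //.
  by rewrite lt0n -ltnS ltn_ord andbT; apply/eqP => ?; apply/i0/val_inj.
have apart (i j : 'I_n.+1) : (i < j)%N -> j != ordS i -> i != ordS j -> [disjoint E i & E j].
  move=> ij jSi iSj; apply/pred0P => x /=; apply/negP => /andP[xi xj].
  have jn : (j <= n)%N by rewrite -ltnS.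
  have ij1 : (i.+1 < j)%N.
    rewrite ltn_neqAle ij andbT eq_sym; apply: contra jSi => /eqP h.
    by apply/eqP/val_inj; rewrite /= modn_small -h ?ltn_ord.
  (* A common vertex other than [w] is a chord; [w] itself forces i = 0 and j = n, which are
     cyclically consecutive. *)
  have [xw|xw] := eqVneq x w; last by apply: (chord i j x) => //; rewrite ij1.
  move: xi xj; rewrite xw /E => wi wj.
  have i0 : i = 0%N :> nat.
    apply/eqP; apply: contraT; rewrite -lt0n => i0.
    by have := inner i; rewrite i0 wi (leq_trans ij jn) => /(_ isT).
  have jn' : j = n :> nat.
    apply/eqP; rewrite eqn_leq jn leqNgt; apply/negP => jn'.
    by have := inner j; rewrite wj jn' (leq_ltn_trans _ ij) // => /(_ isT).
  by case/eqP: iSj; apply/val_inj; rewrite /= i0 jn' modnn.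
apply: (Hacyc (c := v) (d := E)); split=> //.
- split=> // i j; rewrite /v.
  have ipos (k : 'I_n.+1) : k <> ord0 -> (0 < k <= n)%N.
    by move=> k0; rewrite lt0n -ltnS ltn_ord andbT; apply/eqP => ?; apply/k0/val_inj.
  case: eqP => [->|/ipos i0]; case: eqP => [->|/ipos j0] // h.
  + by have [] := yP j j0; rewrite -h eqxx.
  + by have [] := yP i i0; rewrite h eqxx.
  have [yiw yi1 yi2] := yP i i0; have [yjw yj1 yj2] := yP j j0.
  apply/val_inj; case: (ltngtP i j) => // ij; exfalso.
    by apply: (chord i.-1 j (y i)) => //; [lia|rewrite h].
  by apply: (chord j.-1 i (y i)) => //; [lia|rewrite h].
- move=> i; apply/setP => x; rewrite !inE; apply/andP/eqP => [[xp xi]|->//].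
  apply: contraTeq isT => xv; have /Einj : E (ord_pred i) = E i.
    exact: (linear_eq (EH _) (EH _) xv).
  move=> h; have := predE i; rewrite h; case: eqP => [-> /= n0|/eqP i0].
    by rewrite -n0 in n2.
  by move=> ii; case/eqP: i0; apply/val_inj => /=; lia.
- move=> i j ji jSi iSj; case: (ltngtP i j) => [ij|ij|/val_inj ij].
  + exact: apart.
  + by rewrite disjoint_sym; apply: apart.
  + by rewrite ij eqxx in ji.
Qed.

(** A [meet_off w] path from [e] to a different edge through [w] would be a closed chain. *)
Lemma branch_acyclic w e f : e \in edges H -> w \in e -> w \in f ->
  f \in branch w e -> f = e.
Proof.
move=> eH we wf; rewrite inE => /connectP[s sp fE]; apply/eqP; apply: contraT => fe.
case: (@no_closed_chain (size s) w (nth set0 (e :: s))).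
have step i : (i < size s)%N -> meet_off w (nth set0 (e :: s) i) (nth set0 s i).
  by move=> si; apply/pathP.
split=> //.
- case=> [//|i] /= si; by case/meet_offP: (step i si).
- by move=> i /step/meet_offP[].
- by rewrite -[size s]/(size (e :: s)).-1 nth_last /= -fE.
- by rewrite -[size s]/(size (e :: s)).-1 nth_last /= -fE eq_sym.
Qed.

End Branch.

(** * Hypertrees: spines, centroids and vertex counts *)

Lemma card_bigcup_disjoint (I T : finType) (P : pred I) (F : I -> {set T}) :
  (forall i j, P i -> P j -> i != j -> [disjoint F i & F j]) ->
  #|\bigcup_(i | P i) F i| = (\sum_(i | P i) #|F i|)%N.
Proof.
move=> Fdisj; pose G i := if P i then F i else set0.
have -> : \bigcup_(i | P i) F i = \bigcup_i G i by rewrite big_mkcond.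
rewrite -sum1_card partition_disjoint_bigcup => [|i j ij].
  rewrite [RHS]big_mkcond; apply: eq_bigr => i _; rewrite /G sum1_card.
  by case: ifP; rewrite ?cards0.
rewrite /G; case: ifP => Pi; last by rewrite disjoints_subset sub0set.
case: ifP => Pj; first exact: Fdisj.
by rewrite disjoint_sym disjoints_subset sub0set.
Qed.

Section Tree.
Variables (V : finType) (H : hypergraph V) (m : nat).
Implicit Types (v w x r : V) (e f g : {set V}).
Hypotheses (m2 : (2 <= m)%N) (Hunif : uniform H m) (Htree : hypertree H).

Let Hconn : connected_hypergraph H. Proof. by case: Htree. Qed.
Let Hlin : linear_hypergraph H. Proof. by case: Htree. Qed.
Let Hnp e : e \in edges H -> (#|[set v in e | non_pendant H v]| <= 2)%N.
Proof. by case: Htree => _ _ _; apply. Qed.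
Let acyclic w e f : e \in edges H -> w \in e -> w \in f ->
  f \in branch H w e -> f = e.
Proof. by apply: branch_acyclic => //; case: Htree. Qed.

Lemma non_pendantP v : reflect
  (exists e f, [/\ e \in edges H, f \in edges H, v \in e, v \in f & e != f])
  (non_pendant H v).
Proof.
apply: (iffP card_gt1P) => -[e [f]].
  by rewrite !inE => -[/andP[eH ve] /andP[fH vf] ef]; exists e, f.
by move=> [eH fH ve vf ef]; exists e, f; rewrite !inE eH fH ve vf ef.
Qed.

Lemma branch_disjoint v e f : e \in edges H -> f \in edges H ->
  v \in e -> v \in f -> e != f -> [disjoint branch H v e & branch H v f].
Proof.
move=> eH fH ve vf; apply: contraNT => /pred0Pn[g /= /andP[ge gf]].
apply/eqP; apply: (acyclic fH vf ve).
by apply: branch_trans gf _; rewrite branch_sym.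
Qed.

(** If a branch at [v] beyond [e] returned to [w], it would contain [e], a second edge through
    [v]. *)
Lemma branch_child_notin w e v f g : e \in edges H -> w \in e -> v \in e -> v != w ->
  f \in edges H -> v \in f -> f != e -> g \in branch H v f -> w \notin g.
Proof.
move=> eH we ve vw fH vf fe gf; apply: contra fe => wg.
rewrite eq_sym; apply/eqP/(acyclic fH vf ve).
by apply: (branch_step gf (branch_edges fH gf) eH _ wg we); rewrite eq_sym.
Qed.

Lemma branch_child_sub w e v f g : e \in edges H -> w \in e -> v \in e -> v != w ->
  f \in edges H -> v \in f -> f != e -> g \in branch H v f -> g \in branch H w e.
Proof.
move=> eH we ve vw fH vf fe gf.
(* Membership in the child branch is carried through the induction, because it keeps the linking
   vertices different from [w]. *)
have [] // : g \in branch H v f /\ g \in branch H w e.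
move: g gf; apply: (branch_ind fH).
  by split; [exact: branch_refl|apply: (branch_step (branch_refl _ _ _) eH fH vw)].
move=> g g' x gH g'H xv xg xg' [gf ge].
have g'f := branch_step gf gH g'H xv xg xg'; split=> //.
apply: (branch_step ge gH g'H _ xg xg'); apply: contraTneq xg => ->.
exact: (branch_child_notin eH we ve vw fH vf fe gf).
Qed.

(* Everything that hangs on [e] away from [w] is attached at [v]. *)
Definition spine w e v := [/\ v \in e, v != w
  & forall x g, x \in e -> x != w -> x != v -> g \in edges H -> x \in g -> g = e].

Lemma spine_non_pendant w e v : e \in edges H -> non_pendant H w -> non_pendant H v ->
  w \in e -> v \in e -> v != w -> spine w e v.
Proof.
move=> eH nw nv we ve vw; split=> // x g xe xw xv gH xg; apply: contraTeq isT => ge.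
have := Hnp eH; rewrite leqNgt => /negP[]; apply/card_gt2P; exists w, v, x.
have nx : non_pendant H x by apply/non_pendantP; exists e, g; rewrite eq_sym.
by split; split; rewrite ?inE ?we ?ve ?xe // eq_sym.
Qed.

(** A second non-pendant vertex of [e] serves as [v]; if there is none, nothing hangs on [e] away
    from [w] and any other vertex serves. *)
Lemma spine_exists w e : e \in edges H -> non_pendant H w -> w \in e ->
  exists v, spine w e v.
Proof.
move=> eH nw we.
have [/existsP[v /and3P[ve vw nv]]|] :=
  boolP [exists v, [&& v \in e, v != w & non_pendant H v]].
  by exists v; apply: spine_non_pendant.
rewrite negb_exists => /forallP none.
have [v ve vw] : exists2 v, v \in e & v != w.
  have /card_gt1P[x [y [xe ye xy]]] : (1 < #|e|)%N by rewrite Hunif.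
  by have [xw|] := eqVneq x w; [exists y => //; rewrite -xw eq_sym|exists x].
exists v; split=> // x g xe xw xv gH xg; apply: contraTeq isT => ge.
have /negP[] := none x; rewrite xe xw; apply/non_pendantP.
by exists e, g; rewrite eq_sym.
Qed.

Lemma branch_spine w e v : e \in edges H -> w \in e -> spine w e v ->
  branch H w e = e |: \bigcup_(f | [&& f \in edges H, v \in f & f != e]) branch H v f.
Proof.
move=> eH we [ve vw others]; apply/setP => g; rewrite in_setU1.
apply/idP/orP => [ge|[/eqP->|/bigcupP[f /and3P[fH vf fe] gf]]]; last first.
- exact: (branch_child_sub eH we ve vw fH vf fe gf).
- exact: branch_refl.
move: g ge; apply: (branch_ind eH); first by left.
move=> f g x fH gH xw xf xg [/eqP fe|/bigcupP[h /and3P[hH vh he] fh]].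
  have [->|ge] := eqVneq g e; first by left.
  right; apply/bigcupP; exists g; rewrite ?branch_refl // gH ge andbT.
  have [<- //|xv] := eqVneq x v; rewrite fe in xf.
  by rewrite (others x g) ?eqxx // in ge.
have [xv|xv] := eqVneq x v; last first.
  by right; apply/bigcupP; exists h; [rewrite hH vh|apply: (branch_step fh fH gH xv xf xg)].
have [->|ge] := eqVneq g e; first by left.
right; apply/bigcupP; exists g; rewrite ?branch_refl //.
by rewrite gH ge -xv xg.
Qed.

Lemma card_branch_spine w e v : e \in edges H -> w \in e -> spine w e v ->
  #|branch H w e| =
    (\sum_(f | [&& f \in edges H, v \in f & f != e]) #|branch H v f|).+1.
Proof.
move=> eH we wev; rewrite (branch_spine eH we wev) cardsU1.
have [ve vw _] := wev; rewrite card_bigcup_disjoint; last first.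
  by move=> f g /and3P[fH vf _] /and3P[gH vg _]; apply: branch_disjoint.
case: bigcupP => //= -[f /and3P[fH vf fe] ef].
by rewrite (acyclic fH vf ve ef) eqxx in fe.
Qed.

Lemma sum_card_branch r : (\sum_(e in edges H | r \in e) #|branch H r e| <= #|edges H|)%N.
Proof.
rewrite -card_bigcup_disjoint; last first.
  by move=> e f /andP[eH re] /andP[fH rf]; apply: branch_disjoint.
by apply/subset_leq_card/subsetP => g /bigcupP[e /andP[eH _]]; apply: branch_edges.
Qed.

(** Among the branches that are too big, take one with the fewest edges, at [w] through [e]; the far
    end [v] of [e] is a centroid. The branches at [v] away from [e] are proper parts of it, hence
    not too big, and the branch at [v] through [e] has at most k + 1 - n edges, n being the size of
    the chosen one. *)
Lemma exists_centroid : (exists v, non_pendant H v) ->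
  exists2 r, non_pendant H r &
    forall e, e \in edges H -> r \in e -> (2 * #|branch H r e| <= #|edges H| + 1)%N.
Proof.
move=> [v0 nv0].
pose big w e := [&& non_pendant H w, e \in edges H, w \in e
  & (#|edges H| + 1 < 2 * #|branch H w e|)%N].
have [/existsP[w0 /existsP[e0 b0]]|nobig] := boolP [exists w, exists e, big w e]; last first.
  exists v0 => // e eH ve; rewrite leqNgt; apply: contra nobig => lt.
  by apply/existsP; exists v0; apply/existsP; exists e; apply/and4P.
have [[w e] /= /and4P[nw eH we lt] min] :
   exists2 x : V * {set V}, big x.1 x.2 & forall y, big y.1 y.2 ->
     (#|branch H x.1 x.2| <= #|branch H y.1 y.2|)%N.
  pose P (x : V * {set V}) := big x.1 x.2.
  have b0' : P (w0, e0) by [].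
  by case: (arg_minnP (fun x : V * {set V} => #|branch H x.1 x.2|) b0') => x bx mx; exists x.
have k0 : (0 < #|edges H|)%N by apply/card_gt0P; exists e.
have [v wev] := spine_exists eH nw we; have [ve vw others] := wev.
have cardE := card_branch_spine eH we wev.
(* Without a further edge at [v] the branch would be [e] alone, which is not too big. *)
have [f fv] : exists f, [&& f \in edges H, v \in f & f != e].
  apply/existsP; apply: contraTT lt; rewrite negb_exists => /forallP none.
  by rewrite cardE big_pred0 => [|f]; [rewrite muln1 addn1 ltnS -ltnNge|exact/negbTE].
have [fH vf fe] := and3P fv.
have nv : non_pendant H v by apply/non_pendantP; exists f, e.
have lt_child g : g \in edges H -> v \in g -> g != e ->
    (2 * #|branch H v g| <= #|edges H| + 1)%N.
  move=> gH vg ge; rewrite leqNgt; apply/negP => lt'.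
  have := min (v, g); rewrite /big /= nv gH vg lt' => /(_ isT).
  by rewrite cardE (bigD1 g) /= ?gH ?vg ?ge // ltnNge leq_addr.
exists v => // g gH vg; have [->|] := eqVneq g e; last exact: lt_child.
have := sum_card_branch v; rewrite (bigD1 e) /= ?eH ?ve //.
have -> : (\sum_(i | (i \in edges H) && (v \in i) && (i != e)) #|branch H v i|
   = #|branch H w e|.-1)%N by rewrite cardE; apply: eq_bigl => i; rewrite andbA.
move: lt; move: #|branch H w e| #|branch H v e| #|edges H| => a b c; clear; lia.
Qed.

(** A path from [r] to another vertex of [f] never returns to [r], so it stays in the branch of its
    first edge. *)
Lemma branch_cover r f : f \in edges H ->
  exists e, [/\ e \in edges H, r \in e & f \in branch H r e].
Proof.
move=> fH; have [y yf yr] : exists2 y, y \in f & y != r.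
  have /card_gt1P[x [y [xe ye xy]]] : (1 < #|f|)%N by rewrite Hunif.
  by have [xw|] := eqVneq x r; [exists y => //; rewrite -xw eq_sym|exists x].
have [_ [[|[e v] s] [hs yE _]]] := Hconn r y.
  by rewrite -yE eqxx in yr.
case/and3P: hs => /= /andP[/and3P[eH re ve] ps] _.
rewrite inE negb_or => /andP[/andP[rv rs] _]; exists e; split=> //.
have main : forall (s : seq ({set V} * V)) (e' : {set V}) u, e' \in branch H r e ->
    u \in e' -> u != r -> r \notin unzip2 s -> 
    path (fun p q : {set V} * V => [&& q.1 \in edges H, p.2 \in q.1 & q.2 \in q.1]) (e', u) s ->
    exists2 e'', e'' \in branch H r e & last u (unzip2 s) \in e''.
  elim=> [|[e2 u2] s' IHs] e' u e'e ue' ur /=; first by exists e'.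
  rewrite inE negb_or => /andP[ru2 rs'] /andP[/and3P[e2H ue2 u2e2]] ps'.
  apply: (IHs e2 u2) => //; last by rewrite eq_sym.
  exact: (branch_step e'e (branch_edges eH e'e) e2H ur ue' ue2).
have [|e' e'e] := main s e v (branch_refl H r e) ve _ rs ps; first by rewrite eq_sym.
rewrite /= in yE; rewrite yE => ye'.
exact: (branch_step e'e (branch_edges eH e'e) fH yr ye' yf).
Qed.

Lemma vertex_covered r v : non_pendant H r -> exists2 f, f \in edges H & v \in f.
Proof.
move=> nr; have [->|vr] := eqVneq v r.
  by case/non_pendantP: nr => e [_ [eH _ re _ _]]; exists e.
have [_ [[|[e u] t] [hs uE _]]] := Hconn v r; first by rewrite -uE eqxx in vr.
by case/and3P: hs => /= /andP[/and3P[eH ve _] _] _ _; exists e.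
Qed.

Definition branch_vertices w e := cover (branch H w e) :\ w.

Lemma branch_vertices_disjoint v e f : e \in edges H -> f \in edges H ->
  v \in e -> v \in f -> e != f -> [disjoint branch_vertices v e & branch_vertices v f].
Proof.
move=> eH fH ve vf; apply: contraNT => /pred0Pn[x /= /andP[]].
rewrite !inE => /andP[xv /bigcupP[g ge xg]] /andP[_ /bigcupP[h hf xh]].
apply/eqP; apply: (acyclic fH vf ve).
have gf := branch_step hf (branch_edges fH hf) (branch_edges eH ge) xv xh xg.
by apply: branch_trans gf _; rewrite branch_sym.
Qed.

(** Along the spine, [e] contributes its m - 1 vertices other than [w], and the branches at the far
    end contribute disjoint sets that avoid these. *)
Lemma card_branch_vertices w e : e \in edges H -> non_pendant H w -> w \in e ->
  (#|branch H w e| * m.-1 <= #|branch_vertices w e|)%N.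
Proof.
have [n] := ubnP #|branch H w e|; elim: n w e => // n IHn w e.
rewrite ltnS => lt eH nw we; have [v wev] := spine_exists eH nw we.
have [ve vw _] := wev; rewrite (card_branch_spine eH we wev) in lt *.
rewrite mulSn big_distrl /=.
have -> : m.-1 = #|e :\ w| by rewrite -(Hunif eH) [in LHS](cardsD1 w) we.
pose P f := [&& f \in edges H, v \in f & f != e].
pose F := \bigcup_(f | P f) branch_vertices v f.
apply: (@leq_trans (#|e :\ w| + #|F|)).
  rewrite leq_add2l /F card_bigcup_disjoint; last first.
    by move=> f g /and3P[fH vf _] /and3P[gH vg _]; apply: branch_vertices_disjoint.
  apply: leq_sum => f Pf; have [fH vf fe] := and3P Pf.
  have -> : #|e :\ w| = m.-1 by rewrite -(Hunif eH) [in RHS](cardsD1 w) we.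
  apply: IHn => //; last by apply/non_pendantP; exists f, e.
  by apply: leq_trans lt; rewrite ltnS (bigD1 f) //= leq_addr.
have eF : [disjoint e :\ w & F].
  apply/pred0Pn => -[x /= /andP[]]; rewrite !inE => /andP[xw xe] /bigcupP[f /and3P[fH vf fe]].
  rewrite !inE => /andP[xv /bigcupP[g gf xg]].
  have := acyclic fH vf ve (branch_step gf (branch_edges fH gf) eH xv xg xe).
  by move=> ef; rewrite ef eqxx in fe.
rewrite -cardsUI (disjoint_setI0 eF) cards0 addn0; apply/subset_leq_card/subsetP => x.
rewrite !inE => /orP[/andP[-> xe]|/bigcupP[f /and3P[fH vf fe]]].
  by apply/bigcupP; exists e; rewrite ?branch_refl.
rewrite !inE => /andP[xv /bigcupP[g gf xg]].
have wg := branch_child_notin eH we ve vw fH vf fe gf.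
have ge := branch_child_sub eH we ve vw fH vf fe gf.
by rewrite (contraNneq _ wg) /=; [apply/bigcupP; exists g|move=> <-].
Qed.

Lemma sum_card_branch_eq r :
  (\sum_(e in edges H | r \in e) #|branch H r e| = #|edges H|)%N.
Proof.
apply/eqP; rewrite eqn_leq sum_card_branch /= -card_bigcup_disjoint; last first.
  by move=> e f /andP[eH re] /andP[fH rf]; apply: branch_disjoint.
apply/subset_leq_card/subsetP => f /(branch_cover r)[e [eH re fe]].
by apply/bigcupP; exists e; rewrite ?eH.
Qed.

(** In the equality case this lower bound turns a surjection from the vertices of T_d onto [V] into
    a bijection. *)
Lemma card_vertices : (exists v, non_pendant H v) -> (#|edges H| * m.-1 < #|V|)%N.
Proof.
move=> [r nr]; rewrite -(sum_card_branch_eq r) big_distrl /=.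
apply: (@leq_ltn_trans #|~: [set r]|); last first.
  by rewrite -[X in (_ < X)%N](cardsC [set r]) cards1.
pose F := \bigcup_(e in edges H | r \in e) branch_vertices r e.
apply: (@leq_trans #|F|).
  rewrite /F card_bigcup_disjoint; last first.
    by move=> e f /andP[eH re] /andP[fH rf]; apply: branch_vertices_disjoint.
  by apply: leq_sum => e /andP[eH re]; apply: card_branch_vertices.
apply/subset_leq_card/subsetP => x /bigcupP[e _]; rewrite !inE => /andP[-> _] //.
Qed.

End Tree.

(** * Paths as indexed chains of edges *)

Section Chain.
Variables (V : finType) (H : hypergraph V).
Implicit Types (v w : V) (e f : {set V}).

(* A path of [j.+1] edges, the first of which is [e], starts at [w]. Only neighbouring
   vertices and edges are required to differ: in a hypertree this suffices. *)
Fixpoint deep (j : nat) w e : Prop :=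
  if j is j'.+1 then
    exists v f, [/\ v \in e, v != w, f \in edges H, v \in f & f != e /\ deep j' v f]
  else True.

Definition edge_chain d (v : nat -> V) (e : nat -> {set V}) : Prop :=
  [/\ forall i, (i < d)%N -> [/\ e i \in edges H, v i \in e i & v i.+1 \in e i],
      {in [pred i | (i <= d)%N] &, injective v}
    & {in [pred i | (i < d)%N] &, injective e}].

Lemma hpath_edge_chain u s : hpath H u s ->
  edge_chain (size s) (nth u (u :: unzip2 s)) (nth set0 (unzip1 s)).
Proof.
case/and3P => ps ue uv; split=> [i si|i j|i j].
- have := pathP (set0, u) ps i si.
  rewrite (nth_map (set0, u)) // -[u :: unzip2 s]/(unzip2 ((set0, u) :: s)).
  rewrite !(nth_map (set0, u)) //=; last exact: ltnW.
  by move=> /and3P[].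
- rewrite !inE => hi hj /eqP; rewrite nth_uniq ?size_map // => [/eqP//||].
  + by rewrite /= size_map ltnS.
  + by rewrite /= size_map ltnS.
- by rewrite !inE => hi hj /eqP; rewrite nth_uniq ?size_map // => /eqP.
Qed.

Variables (d : nat) (v : nat -> V) (e : nat -> {set V}).
Hypothesis ch : edge_chain d v e.

Lemma deep_forward i j : (i + j < d)%N -> deep j (v i) (e i).
Proof.
have [eE vinj einj] := ch; elim: j i => //= j IHj i ij.
have hi : (i.+1 < d)%N by apply: leq_trans ij; rewrite ltnS addnS ltnS leq_addr.
have [eH vi vi1] := eE i (ltnW hi); have [eH1 vi1' _] := eE i.+1 hi.
exists (v i.+1), (e i.+1); split=> //.
  apply/eqP => /vinj; rewrite !inE (ltnW hi) (ltnW (ltnW hi)) => /(_ isT isT)/eqP.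
  by rewrite eqn_leq ltnn.
split; last by apply: IHj; rewrite addSnnS.
by apply/eqP => /einj; rewrite !inE hi (ltnW hi) => /(_ isT isT)/eqP; rewrite eqn_leq ltnn.
Qed.

Lemma deep_backward i j : (i < d)%N -> (j <= i)%N -> deep j (v i.+1) (e i).
Proof.
have [eE vinj einj] := ch; elim: j i => //= j IHj [//|i] id ji.
have [eH vi vi1] := eE i.+1 id; have [eH1 vi1' vi'] := eE i (ltnW id).
exists (v i.+1), (e i); split=> //.
  by apply/eqP => /vinj; rewrite !inE (ltnW id) id => /(_ isT isT)/eqP; rewrite eqn_leq ltnn andbF.
split; last by apply: IHj => //; apply: ltnW.
by apply/eqP => /einj; rewrite !inE id (ltnW id) => /(_ isT isT)/eqP; rewrite eqn_leq ltnn andbF.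
Qed.

Lemma chain_in_branch r f : (forall i, (0 < i < d)%N -> v i != r) ->
  e 0%N \in branch H r f -> forall i, (i < d)%N -> e i \in branch H r f.
Proof.
have [eE _ _] := ch; move=> vr e0 i; elim: i => // i IHi id.
have [eH _ vi] := eE i (ltnW id); have [eH1 vi' _] := eE i.+1 id.
by apply: (branch_step (IHi (ltnW id)) eH eH1 _ vi vi'); apply: vr.
Qed.

Lemma card_chain_edges (A : {set {set V}}) a b : (a <= b <= d)%N ->
  (forall i, (a <= i < b)%N -> e i \in A) -> (b - a <= #|A|)%N.
Proof.
have [_ _ einj] := ch; move=> /andP[ab bd] eA.
have -> : (b - a)%N = #|[set e (a + i)%N | i : 'I_(b - a)]|.
  rewrite card_imset ?card_ord // => i j /einj; rewrite !inE => h.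
  apply/val_inj/eqP; rewrite -(eqn_add2l a); apply/eqP/h;
    by apply: leq_trans bd; rewrite -ltn_subRL ltn_ord.
apply/subset_leq_card/subsetP => _ /imsetP[i _ ->]; apply: eA.
by rewrite leq_addr -ltn_subRL ltn_ord.
Qed.

End Chain.

(** * Weights of branches *)

Section Subsolution.
Variables (R : realFieldType) (V : finType) (H : hypergraph V) (m p : nat) (s : R)
  (z : V -> R).
Implicit Types (v w x r : V) (e f g : {set V}).
Let M : R := m%:R - 1.
Let k := #|edges H|.
Hypotheses (m2 : (2 <= m)%N) (Hunif : uniform H m) (Htree : hypertree H).
Hypotheses (p1 : (0 < p)%N) (kp : 4 * p%:R ^+ 2 + 1 <= k%:R :> R).
Hypotheses (sM : M - 1 < s) (Ns : (k%:R - 2 * p%:R + 2) * leaf M s <= s).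

Definition edge_sum w e : R := \sum_(u in e | u != w) z u.

Hypotheses (z_ge0 : forall v, 0 <= z v)
  (z_sub : forall v, s * z v <= \sum_(e in edges H | v \in e) edge_sum v e).

Let g1 := leaf M s.
Let n w e := #|branch H w e|.

Let M1 : 1 <= M.
Proof. by rewrite /M lerBrDr -[1 + 1]/(2%:R) ler_nat. Qed.

Let g1_gt0 : 0 < g1. Proof. exact: leaf_gt0. Qed.

Let n_gt0 w e : (0 < n w e)%N.
Proof. by apply/card_gt0P; exists e; apply: branch_refl. Qed.

Lemma edge_sum_swap w e u : w \in e -> u \in e -> z u + edge_sum u e = z w + edge_sum w e.
Proof.
have total x : x \in e -> z x + edge_sum x e = \sum_(y in e) z y.
  by move=> xe; rewrite (bigD1 x).
by move=> we ue; rewrite !total.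
Qed.

(** The m - 2 vertices of [e] other than [w] and [v] lie on no other edge. Summing the subsolution
    inequality over them gives one premise of [edge_le_transfer], and its instance at [v] gives the
    other. *)
Lemma spine_le_transfer w e v (G : R) : e \in edges H -> w \in e -> spine H w e v ->
  G < s - shift M s ->
  \sum_(f | [&& f \in edges H, v \in f & f != e]) edge_sum v f <= G * z v ->
  edge_sum w e <= transfer M s G * z w.
Proof.
move=> eH we wev Gq childG; have [ve vw others] := wev.
pose Y := \sum_(u in e | (u != w) && (u != v)) z u.
have sumE : edge_sum w e = z v + Y.
  rewrite /edge_sum (bigD1 v) /= ?ve ?vw //; congr (_ + _).
  by apply: eq_bigl => u; rewrite andbA.
rewrite sumE; apply: edge_le_transfer => //.
  have card_others : \sum_(u in e | (u != w) && (u != v)) 1 = M - 1 :> R.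
    have cardE : #|e :\ w :\ v| = (m - 2)%N.
      rewrite -(Hunif eH) (cardsD1 w e) we (cardsD1 v (e :\ w)) !inE ve vw /=.
      by rewrite !add1n subn2.
    rewrite (eq_bigl (mem (e :\ w :\ v))) => [|u]; last first.
      by rewrite !inE; case: (u == w); case: (u == v); case: (u \in e).
    by rewrite sumr_const cardE natrB // /M; ring.
  rewrite -card_others mulr_sumr mulr_suml; apply: ler_sum => u /and3P[ue uw uv].
  have := z_sub u; rewrite (big_pred1 e) => [h|f /=]; last first.
    by apply/andP/eqP => [[fH uf]|->//]; apply: others uf.
  by have := edge_sum_swap we ue; rewrite mul1r -sumE; move: h; lra.
have := z_sub v; rewrite (bigD1 e) /= ?eH ?ve //.
rewrite (eq_bigl (fun f => [&& f \in edges H, v \in f & f != e])) => [h|f]; last first.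
  by rewrite andbA.
by have := edge_sum_swap we ve; rewrite -sumE; move: h childG; lra.
Qed.

(** For j > 1, contraction between j - 1 leaves and 0 shows that [transfer] adds less than one
    leaf. *)
Lemma transfer_leaf (j : nat) : (0 < j)%N -> (2 * j <= k + 1)%N ->
  transfer M s ((j%:R - 1) * g1) <= j%:R * g1 ?= iff (j == 1)%N.
Proof.
case: j => // -[|j] _ hj.
  by apply/leifP/eqP; rewrite subrr mul0r transfer0 // mul1r.
pose G := (j.+2%:R - 1) * g1; have G0 : 0 < G by rewrite mulr_gt0 // subr_gt0 ltr1n.
have p2 : (1 < 2 * p)%N by rewrite (@leq_mul 2 1).
have h0 : 0 <= (1%:R - 1) * leaf M s by rewrite subrr mul0r.
have := transfer_contract M1 sM p1 kp Ns hj p2 (lexx G) h0 G0.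
rewrite transfer0 // -/g1; rewrite -/G => h; apply/leifP => /=.
have -> : j.+2%:R * g1 = G + g1 by rewrite /G; ring.
by move: h; lra.
Qed.

Lemma children_le w e v : e \in edges H -> w \in e -> spine H w e v ->
  (forall f, f \in edges H -> v \in f -> f != e -> edge_sum v f <= (n v f)%:R * g1 * z v) ->
  \sum_(f | [&& f \in edges H, v \in f & f != e]) edge_sum v f
    <= ((n w e)%:R - 1) * g1 * z v.
Proof.
move=> eH we wev child.
have -> : (n w e)%:R - 1 = \sum_(f | [&& f \in edges H, v \in f & f != e]) (n v f)%:R :> R.
  by rewrite /n (card_branch_spine Htree eH we wev) -natr1 addrK natr_sum.
by rewrite !mulr_suml; apply: ler_sum => f /and3P[fH vf fe]; apply: child.
Qed.

Lemma below_pole_branch j : (0 < j)%N -> (2 * j <= k + 1)%N -> (j%:R - 1) * g1 < s - shift M s.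
Proof.
move=> j0 hj; have p2 : (1 < 2 * p)%N by rewrite (@leq_mul 2 1).
have [] := transfer_slope M1 sM p1 kp Ns (n := j) (j := 1) (G := (j%:R - 1) * g1) (H := 0) hj p2.
- by [].
- by rewrite subrr mul0r.
by move=> h _ _; rewrite -subr_gt0.
Qed.

Lemma child_card w e v f : e \in edges H -> w \in e -> spine H w e v ->
  f \in edges H -> v \in f -> f != e -> (n v f < n w e)%N.
Proof.
move=> eH we wev fH vf fe; rewrite /n (card_branch_spine Htree eH we wev) ltnS.
by rewrite (bigD1 f) /= ?fH ?vf // leq_addr.
Qed.

(** By induction each branch at the far end is worth at most one leaf per edge, and together they
    have n - 1 edges. The outer [transfer] is kept because [branch_lt] and [branch_far] estimate it
    strictly. *)
Lemma branch_le_transfer w e : e \in edges H -> non_pendant H w -> w \in e ->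
  (2 * n w e <= k + 1)%N ->
  edge_sum w e <= transfer M s (((n w e)%:R - 1) * g1) * z w.
Proof.
have [N] := ubnP (n w e); elim: N w e => // N IHN w e ltN eH nw we hn.
have [v wev] := spine_exists m2 Hunif Htree eH nw we.
apply: (spine_le_transfer eH we wev); first exact: below_pole_branch.
apply: children_le => // f fH vf fe; have lt := child_card eH we wev fH vf fe.
have hf : (2 * n v f <= k + 1)%N by apply: leq_trans hn; rewrite leq_mul2l /= ltnW.
have nv : non_pendant H v by case: wev => ve _ _; apply/non_pendantP; exists f, e.
apply: le_trans (IHN v f (leq_trans lt _) fH nv vf hf) _ => //.
by rewrite ler_wpM2r //; apply: (transfer_leaf (n_gt0 _ _) hf).
Qed.

Lemma branch_le w e : e \in edges H -> non_pendant H w -> w \in e ->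
  (2 * n w e <= k + 1)%N -> edge_sum w e <= (n w e)%:R * g1 * z w.
Proof.
move=> eH nw we hn; apply: le_trans (branch_le_transfer eH nw we hn) _.
by rewrite ler_wpM2r //; apply: (transfer_leaf (n_gt0 _ _) hn).
Qed.

Lemma branch_lt w e : e \in edges H -> non_pendant H w -> w \in e ->
  (2 * n w e <= k + 1)%N -> 0 < z w -> n w e != 1%N ->
  edge_sum w e < (n w e)%:R * g1 * z w.
Proof.
move=> eH nw we hn zw n1; apply: le_lt_trans (branch_le_transfer eH nw we hn) _.
by rewrite ltr_pM2r // (lt_leif (transfer_leaf (n_gt0 _ _) hn)).
Qed.

Lemma branch_far w e : e \in edges H -> non_pendant H w -> w \in e ->
  (2 * n w e <= k + 1)%N -> 0 < z w -> (2 * p <= n w e)%N ->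
  edge_sum w e < ((n w e)%:R - 2 * p%:R + 2) * g1 * z w.
Proof.
move=> eH nw we hn zw far; apply: le_lt_trans (branch_le_transfer eH nw we hn) _.
by rewrite ltr_pM2r //; apply: transfer_far M1 sM p1 kp Ns _ far hn.
Qed.

(** If [z w = 0], the upper bound on the non-negative sum over [e] is 0, so the weights vanish on
    [e] and then on the branches further out. *)
Lemma branch_zero w e : e \in edges H -> non_pendant H w -> w \in e ->
  (2 * n w e <= k + 1)%N -> z w = 0 ->
  forall f x, f \in branch H w e -> x \in f -> z x = 0.
Proof.
have [N] := ubnP (n w e); elim: N w e => // N IHN w e ltN eH nw we hn zw.
have ze x : x \in e -> z x = 0.
  have [->//|xw xe] := eqVneq x w; apply/eqP; rewrite eq_le z_ge0 andbT.
  have := branch_le eH nw we hn; rewrite zw mulr0; apply: le_trans.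
  by rewrite /edge_sum (bigD1 x) /= ?xe ?xw // lerDl sumr_ge0.
have [v wev] := spine_exists m2 Hunif Htree eH nw we.
move=> f x; rewrite (branch_spine Htree eH we wev) in_setU1.
case/predU1P=> [->|/bigcupP[g /and3P[gH vg ge] fg]]; first exact: ze.
have ve : v \in e by case: wev.
have nv : non_pendant H v by apply/non_pendantP; exists g, e.
have lt := child_card eH we wev gH vg ge.
have hg : (2 * n v g <= k + 1)%N by apply: leq_trans hn; rewrite leq_mul2l /= ltnW.
exact: (IHN v g (leq_trans lt ltN) gH nv vg hg (ze v ve)).
Qed.

(** At the far end [v], the continuation of the path is bounded by induction and the other branches
    by leaves, together G = [ray (j + 1)] plus the surplus leaves. Contraction between G and
    [ray (j + 1)] lets the surplus leaves pass through [transfer], with strict loss if there are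
    any. *)
Lemma deep_le j w e : deep H j w e -> e \in edges H -> non_pendant H w -> w \in e ->
  (2 * n w e <= k + 1)%N -> (j.+1 < 2 * p)%N ->
  [/\ (j < n w e)%N, edge_sum w e <= (ray M s j.+1 + ((n w e)%:R - j.+1%:R) * g1) * z w
  & 0 < z w -> n w e != j.+1 ->
    edge_sum w e < (ray M s j.+1 + ((n w e)%:R - j.+1%:R) * g1) * z w].
Proof.
elim: j w e => [|j IHj] w e.
  move=> _ eH nw we hn _.
  have -> : ray M s 1 + ((n w e)%:R - 1) * g1 = (n w e)%:R * g1.
    by rewrite [ray M s 1]/= transfer0 // -/g1; ring.
  split; [exact: n_gt0|exact: branch_le|exact: branch_lt].
move=> [v [f [ve vw fH vf [fe dj]]]] eH nw we hn jp.
have nv : non_pendant H v by apply/non_pendantP; exists f, e.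
have wev := spine_non_pendant Htree eH nw nv we ve vw.
have lt := child_card eH we wev fH vf fe.
have hsmall g : g \in edges H -> v \in g -> g != e -> (2 * n v g <= k + 1)%N.
  move=> gH vg ge; apply: leq_trans hn.
  by rewrite leq_mul2l /= ltnW // child_card.
have [nj le_f _] := IHj v f dj fH nv vf (hsmall f fH vf fe) (ltnW jp).
pose G := ray M s j.+1 + ((n w e)%:R - j.+2%:R) * g1.
have nwe : (j.+1 < n w e)%N by apply: leq_trans lt.
have /andP[r0 rj] := ray_bounds M1 sM p1 kp Ns (ltnW (ltnW jp)).
have G_le : G <= ((n w e)%:R - 1) * g1.
  have -> : ((n w e)%:R - 1) * g1 = j.+1%:R * g1 + ((n w e)%:R - j.+2%:R) * g1.
    by rewrite -[j.+2%:R]natr1; ring.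
  by rewrite /G lerD2r.
have H_le : ray M s j.+1 <= (j.+2%:R - 1) * g1 by rewrite -[j.+2%:R]natr1 addrK.
have Gq : G < s - shift M s.
  exact: le_lt_trans (below_pole_branch (n_gt0 w e) hn).
have sumG : \sum_(f0 | [&& f0 \in edges H, v \in f0 & f0 != e]) edge_sum v f0 <= G * z v.
  have cardE : (n w e)%:R - 1 = (n v f)%:R +
      \sum_(g | [&& g \in edges H, v \in g & g != e] && (g != f)) (n v g)%:R :> R.
    rewrite /n (card_branch_spine Htree eH we wev) -natr1 addrK (bigD1 f) /= ?fH ?vf //.
    by rewrite natrD natr_sum.
  rewrite (bigD1 f) /= ?fH ?vf //.
  have -> : G = (ray M s j.+1 + ((n v f)%:R - j.+1%:R) * g1) +
      (\sum_(g | [&& g \in edges H, v \in g & g != e] && (g != f)) (n v g)%:R) * g1.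
    rewrite /G; have -> : (n w e)%:R - j.+2%:R = (n w e)%:R - 1 - j.+1%:R :> R.
      by rewrite -[j.+2%:R]natr1; ring.
    by rewrite cardE; ring.
  rewrite mulrDl lerD // !mulr_suml; apply: ler_sum => g /andP[/and3P[gH vg ge] _].
  by apply: branch_le => //; apply: hsmall.
have le_t := spine_le_transfer eH we wev Gq sumG.
have rayE : ray M s j.+2 = transfer M s (ray M s j.+1) by [].
have [eqn|neqn] := eqVneq (n w e) j.+2.
  have GE : G = ray M s j.+1 by rewrite /G eqn subrr mul0r addr0.
  by split=> //; move: le_t; rewrite GE -rayE eqn subrr mul0r addr0.
have HG : ray M s j.+1 < G.
  rewrite /G ltrDl mulr_gt0 // subr_gt0 ltr_nat ltn_neqAle eq_sym neqn; exact: nwe.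
have := transfer_contract M1 sM p1 kp Ns hn jp G_le H_le HG; rewrite -rayE => contr.
have lt_t : transfer M s G < ray M s j.+2 + ((n w e)%:R - j.+2%:R) * g1.
  by move: contr; rewrite /G; lra.
split=> //; first by apply: le_trans le_t _; rewrite ler_wpM2r // ltW.
by move=> zw _; apply: le_lt_trans le_t _; rewrite ltr_pM2r.
Qed.


Lemma centroid_gt0 r : (exists v, z v != 0) -> non_pendant H r ->
  (forall e, e \in edges H -> r \in e -> (2 * n r e <= k + 1)%N) -> 0 < z r.
Proof.
move=> [v zv] nr hr; rewrite lt_neqAle z_ge0 andbT eq_sym; apply: contra zv => /eqP zr.
have [f fH vf] := vertex_covered Htree v nr.
have [e [eH re fe]] := branch_cover m2 Hunif Htree r fH.
by rewrite (branch_zero eH nr re (hr e eH re) zr fe vf).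
Qed.

(** The total weight around [r] is [s * z r] minus a sum of non-negative slacks. The subsolution
    inequality at [r] makes this sum at most 0, so every slack vanishes and each estimate is
    sharp. *)
Lemma centroid_rigid r (v : nat -> V) (e : nat -> {set V}) : (exists v, z v != 0) ->
  s = (k%:R - 2 * p%:R) * g1 + 2 * ray M s p ->
  edge_chain H (2 * p) v e -> non_pendant H r ->
  (forall e, e \in edges H -> r \in e -> (2 * n r e <= k + 1)%N) ->
  [/\ \sum_(f in edges H | r \in f) edge_sum r f <= s * z r,
      r = v p, n r (e p) = p, n r (e p.-1) = p
    & forall f, f \in edges H -> r \in f -> f != e p -> f != e p.-1 -> n r f = 1%N].
Proof.
move=> z0 sE ch nr hr; have zr := centroid_gt0 z0 nr hr.
have [eE vinj einj] := ch.
have p2 : (0 < 2 * p)%N by rewrite muln_gt0.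
have sum_n : \sum_(f in edges H | r \in f) (n r f)%:R = k%:R :> R.
  by rewrite -natr_sum (sum_card_branch_eq m2 Hunif Htree).
have r_sub := z_sub r.
(* If [r] is not an inner vertex of the path, one branch contains the whole path; [branch_far] then
   keeps the total strictly below k - 2p + 2 leaves, contradicting [Ns]. *)
case: (pickP (fun i : 'I_(2 * p)%N => (0 < i)%N && (v i == r))) => [[i ip]|off]; last first.
  have off' i : (0 < i < 2 * p)%N -> v i != r.
    by move=> /andP[i0 ip]; have := off (Ordinal ip); rewrite /= i0 => /negbT.
  have [e0H _ _] := eE 0%N p2.
  have [f [fH rf ef]] := branch_cover m2 Hunif Htree r e0H.
  have far : (2 * p <= n r f)%N.
    rewrite -[(2 * p)%N]subn0; apply: (card_chain_edges ch); first by rewrite leqnn.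
    by move=> i /andP[_]; apply: (chain_in_branch ch off' ef).
  have lt_f := branch_far fH nr rf (hr f fH rf) zr far.
  move: r_sub sum_n; rewrite (bigD1 f) /= ?fH // [in X in _ -> X](bigD1 f) /= ?fH // => r_sub sum_n.
  have le_rest : \sum_(g | (g \in edges H) && (r \in g) && (g != f)) edge_sum r g
     <= (\sum_(g | (g \in edges H) && (r \in g) && (g != f)) (n r g)%:R) * g1 * z r.
    rewrite !mulr_suml; apply: ler_sum => g /andP[/andP[gH rg] _].
    by apply: branch_le => //; apply: hr.
  have Ns' := Ns; rewrite -/g1 -sum_n in Ns'.
  have := ler_wpM2r (ltW zr) Ns'; move: r_sub le_rest lt_f.
  set S := \sum_(g | _) (n r g)%:R.
  have -> : ((n r f)%:R + S - 2 * p%:R + 2) * g1 * z r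
    = ((n r f)%:R - 2 * p%:R + 2) * g1 * z r + S * g1 * z r by ring.
  lra.
case: i ip => [//|i] ip /= /eqP vr; rewrite -vr in r_sub sum_n zr nr hr *.
have ip' := ltnW ip; have iSp : (i.+1 <= 2 * p)%N := ltnW ip.
have [eiH _ vi] := eE i ip'; have [ejH vj _] := eE i.+1 ip.
have eij : e i != e i.+1.
  by apply/eqP => /einj; rewrite !inE ip ip' => /(_ isT isT)/eqP; rewrite eqn_leq ltnn andbF.
pose b := (2 * p - i.+1).-1.
have bE : (i.+1 + b.+1 = 2 * p)%N by rewrite /b prednK ?subn_gt0 // subnKC.
have bp : (b.+1 < 2 * p)%N by rewrite -bE addSn ltnS leq_addl.
have df : deep H b (v i.+1) (e i.+1) by apply: (deep_forward ch); rewrite -bE addnS.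
have db : deep H i (v i.+1) (e i) by apply: (deep_backward ch).
have [nf le_f lt_f] := deep_le df ejH nr vj (hr _ ejH vj) bp.
have [nb le_b lt_b] := deep_le db eiH nr vi (hr _ eiH vi) ip.
pose P f := (f \in edges H) && (v i.+1 \in f) && (f != e i) && (f != e i.+1).
have total : \sum_(f in edges H | v i.+1 \in f) edge_sum (v i.+1) f
    = edge_sum (v i.+1) (e i) + (edge_sum (v i.+1) (e i.+1) + \sum_(f | P f) edge_sum (v i.+1) f).
  by rewrite (bigD1 (e i)) ?eiH //= (bigD1 (e i.+1)) ?ejH ?vj ?(eq_sym _ (e i)).
rewrite total; rewrite total in r_sub; move: sum_n.
rewrite (bigD1 (e i)) ?eiH //= (bigD1 (e i.+1)) ?ejH ?vj ?(eq_sym _ (e i)) //= -/P => sum_n.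
pose D f := (n (v i.+1) f)%:R * g1 * z (v i.+1) - edge_sum (v i.+1) f.
have D0 f : P f -> 0 <= D f.
  move=> /andP[/andP[/andP[fH vf] _] _]; rewrite subr_ge0.
  by apply: branch_le => //; apply: hr.
have sumD : \sum_(f | P f) D f = (\sum_(f | P f) (n (v i.+1) f)%:R) * g1 * z (v i.+1)
     - \sum_(f | P f) edge_sum (v i.+1) f.
  by rewrite !mulr_suml -sumrB.
have sumD0 : 0 <= \sum_(f | P f) D f by apply: sumr_ge0.
have pair := ray_pair_le M1 sM p1 kp Ns bE.
(* The four slacks: unequal halves of the path, the two branches containing these halves, and all
   other branches. *)
pose defect := (2 * ray M s p - (ray M s i.+1 + ray M s b.+1)) * z (v i.+1)
   + ((ray M s i.+1 + ((n (v i.+1) (e i))%:R - i.+1%:R) * g1) * z (v i.+1)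
      - edge_sum (v i.+1) (e i))
   + ((ray M s b.+1 + ((n (v i.+1) (e i.+1))%:R - b.+1%:R) * g1) * z (v i.+1)
      - edge_sum (v i.+1) (e i.+1))
   + \sum_(f | P f) D f.
have defectE : edge_sum (v i.+1) (e i) + (edge_sum (v i.+1) (e i.+1) +
    \sum_(f | P f) edge_sum (v i.+1) f) = s * z (v i.+1) - defect.
  have bER : 2 * p%:R = i.+1%:R + b.+1%:R :> R by rewrite -natrM -bE natrD.
  have -> : s * z (v i.+1) = ((k%:R - 2 * p%:R) * g1 + 2 * ray M s p) * z (v i.+1).
    by rewrite -sE.
  by rewrite /defect sumD -sum_n bER; ring.
have key : defect <= 0 by move: r_sub; rewrite defectE; lra.
rewrite /defect in key.
have pair0 : 0 <= (2 * ray M s p - (ray M s i.+1 + ray M s b.+1)) * z (v i.+1).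
  by rewrite mulr_ge0 // subr_ge0 pair.
have ip_eq : i.+1 = p.
  apply/eqP; apply: contraT => ne; have := lt_leif pair; rewrite ne => lt.
  have : 0 < (2 * ray M s p - (ray M s i.+1 + ray M s b.+1)) * z (v i.+1).
    by rewrite mulr_gt0 // subr_gt0.
  by move: key le_f le_b sumD0; lra.
have bp_eq : b.+1 = p by move: bE; rewrite -ip_eq mul2n -addnn => /addnI.
have nb_eq : n (v i.+1) (e i) = i.+1.
  apply/eqP; apply: contraT => /(lt_b zr); by move: key le_f pair0 sumD0; lra.
have nf_eq : n (v i.+1) (e i.+1) = b.+1.
  apply/eqP; apply: contraT => /(lt_f zr); by move: key le_b pair0 sumD0; lra.
have sumD_eq : \sum_(f | P f) D f = 0.
  by apply/eqP; rewrite eq_le sumD0 andbT; move: key le_b le_f pair0; lra.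
rewrite defectE -ip_eq; split=> //.
- by rewrite gerBl /defect; move: le_b le_f pair0 sumD0; lra.
- by rewrite nf_eq bp_eq ip_eq.
move=> f fH vf fe1 fe0; apply/eqP; apply: contraT => nf1.
have := branch_lt fH nr vf (hr f fH vf) zr nf1; rewrite -subr_gt0 -/(D f).
have Pf : P f by rewrite /P fH vf fe0 fe1.
by rewrite (psumr_eq0P D0 sumD_eq Pf) ltxx.
Qed.

End Subsolution.

(** * The extremal hypertree *)

Section TdEdges.
Variables (m d : nat) (c : nat -> nat).
Let W : finType := attach_vertex m (Td_mult (m := m) (d := d) c).

(** Indexing by a sum type makes sums over the edges split into path edges and attached edges. *)
Definition Td_edge (j : 'I_d + {v : loose_path_vertex m d & 'I_(Td_mult c v)}) : {set W} :=
  match j with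
  | inl j => [set inl v | v in loose_path_edge m j]
  | inr t => attached_edge m t
  end.

Lemma mem_path_edge (u : loose_path_vertex m d) (j : 'I_d) :
  ((inl u : W) \in Td_edge (inl j)) = (u \in loose_path_edge m j).
Proof. by rewrite /= mem_imset // => ? ? []. Qed.

Lemma mem_path_edge_attached t (j : 'I_d) : ((inr t : W) \in Td_edge (inl j)) = false.
Proof. by apply/imsetP => -[]. Qed.

Lemma mem_attached_path (u : loose_path_vertex m d) t :
  ((inl u : W) \in Td_edge (inr t)) = (u == tag t).
Proof. by rewrite inE. Qed.

Lemma mem_attached tb t : ((inr tb : W) \in Td_edge (inr t)) = (tb.1 == t).
Proof. by rewrite inE. Qed.

Lemma Td_edges f : (f \in edges (Td m d c)) = [exists j, f == Td_edge j].
Proof.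
rewrite /= inE; apply/orP/existsP => [[/imsetP[e /imsetP[j _ ->] ->]|/imsetP[t _ ->]]|[[j|t] /eqP->]].
- by exists (inl j).
- by exists (inr t).
- by left; apply/imset_f/imset_f.
- by right; apply/imset_f.
Qed.

Lemma Td_edge_linear (u v : W) i j : u != v -> u \in Td_edge i -> v \in Td_edge i ->
  u \in Td_edge j -> v \in Td_edge j -> i = j.
Proof.
case: i j => [i|i] [j|j]; case: u => [u|u]; case: v => [v|v] uv;
  rewrite ?mem_path_edge ?mem_path_edge_attached ?mem_attached_path ?mem_attached //.
- move: u v uv; case=> [u|[u1 u2]] [v|[v1 v2]] uv; rewrite !inE /=.
  + have : (u : nat) != v by apply: contra uv => /eqP/val_inj->.
    by move=> h h1 h2 h3 h4; congr inl; apply/val_inj => /=; lia.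
  + by move=> _ /eqP-> _ /eqP->.
  + by move=> /eqP-> _ /eqP->.
  + by move=> /eqP-> _ /eqP->.
- by move=> _ _ /eqP uj /eqP vj; rewrite uj vj eqxx in uv.
- by move=> /eqP uj /eqP vj; rewrite uj vj eqxx in uv.
- by move=> /eqP uj /eqP vj; rewrite uj vj eqxx in uv.
- by move=> _ /eqP-> _ /eqP->.
- by move=> /eqP-> _ /eqP->.
- by move=> /eqP-> _ /eqP->.
Qed.

End TdEdges.

(** * An explicit eigenvector of the central tree *)

Section CentralTree.
Variables (R : realType) (m k p : nat) (s : R).
Let M : R := m%:R - 1.
Hypotheses (m2 : (2 <= m)%N) (p1 : (0 < p)%N).
Hypotheses (kp : 4 * p%:R ^+ 2 + 1 <= k%:R :> R).
Hypotheses (sM : M - 1 < s) (Ns : (k%:R - 2 * p%:R + 2) * leaf M s <= s).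
Hypothesis sE : s = (k%:R - 2 * p%:R) * leaf M s + 2 * ray M s p.

Let M1 : 1 <= M.
Proof. by rewrite /M lerBrDr -[1 + 1]/(2%:R) ler_nat. Qed.

Let d := (2 * p)%N.
Let c := fun i : nat => if i == p.+1 then (k - d)%N else 0%N.

Let below j : (j < d)%N -> ray M s j < s - shift M s.
Proof. exact: (ray_below_pole M1 sM p1 kp Ns). Qed.

(** In an edge of total weight 1 + [transfer G], whose end nearer the centre has weight 1, the
    eigenvalue equation gives a pendant vertex the total divided by s + 1 and the far end the total
    divided by s + 1 - G; these must add up to [transfer G]. *)
Lemma transfer_edge (G : R) : G < s - shift M s ->
  (1 + transfer M s G) * ((M - 1) / (s + 1) + (s + 1 - G)^-1) = transfer M s G.
Proof.
move=> Gq; rewrite (s_shift M1 sM) (M_shift M1 sM) /transfer.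
have c0 := shift_ge0 M1 sM; have sE' := s_shift M1 sM; set t := shift M s in Gq c0 sE' *.
have w0 : 1 < s - M + 2 by move: (sM); lra.
set w := s - M + 2 in sE' w0 *.
have sE2 : s = (1 + t) * w - 1 by rewrite -sE'; ring.
have w_gt0 : w != 0 by rewrite gt_eqF //; lra.
have t1 : 1 + t != 0 by rewrite gt_eqF //; lra.
have tG : s - t - G != 0 by rewrite gt_eqF //; lra.
have aG : (1 + t) * w - G != 0 by rewrite gt_eqF //; lra.
by rewrite sE2 in tG *; field; rewrite w_gt0 t1 aG tG.
Qed.

Lemma leaf_edge : (1 + leaf M s) * (M / (s + 1)) = leaf M s.
Proof. by rewrite /leaf; field; move: (sM) (M1); lra. Qed.

(* Weight of a path vertex, and total weight of the path edge leading away from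
   it, at distance [l] from the central vertex. *)
Fixpoint ray_weight (l : nat) : R :=
  if l is l'.+1 then
    ray_weight l' * (1 + ray M s (p - l')) / (s + 1 - ray M s (p - l))
  else 1.

Definition ray_edge_weight (l : nat) : R := ray_weight l * (1 + ray M s (p - l)).

Lemma ray_weightS l : (l < p)%N ->
  ray_edge_weight l = ray_weight l.+1 * (s + 1 - ray M s (p - l.+1)).
Proof.
move=> lp; rewrite [ray_weight _]/= -/(ray_edge_weight l) divfK // gt_eqF //.
have := @below (p - l.+1); rewrite /d; have := shift_ge0 M1 sM.
by move=> h0 /(_ _) h; have := h ltac:(lia); lra.
Qed.

Lemma ray_edge_weightE l : (l < p)%N ->
  ray_edge_weight l
    = ray_weight l + ray_weight l.+1 + (M - 1) * (ray_edge_weight l / (s + 1)).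
Proof.
move=> lp; have q := @below (p - l.+1) ltac:(rewrite /d; lia).
have aG : s + 1 - ray M s (p - l.+1) != 0.
  by rewrite gt_eqF //; have := shift_ge0 M1 sM; lra.
have -> : ray_weight l.+1 = ray_edge_weight l / (s + 1 - ray M s (p - l.+1)).
  by rewrite (ray_weightS lp) mulfK.
have := transfer_edge q; rewrite -[transfer _ _ _]/(ray M s (p - l.+1).+1) subnSK //.
rewrite /ray_edge_weight => {1}<-; ring.
Qed.

(** The eigenvalue equation at distance l from the centre. At l = p there is no outer edge, and its
    term vanishes because [ray 0 = 0]. *)
Lemma ray_weight_vertex l : (0 < l <= p)%N ->
  (ray_edge_weight l.-1 - ray_weight l) + (ray_edge_weight l - ray_weight l) = s * ray_weight l.
Proof.
by case: l => // l lp; rewrite (ray_weightS lp) /ray_edge_weight; ring.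
Qed.

Let W : finType := attach_vertex m (Td_mult (m := m) (d := d) c).

(** Path vertices are numbered from 0 to d with centre p. One of the truncated differences vanishes,
    so [level] is the distance to the centre; [edge_level] is the level of the inner end of an
    edge. *)
Definition level (i : nat) := ((i - p) + (p - i))%N.
Definition edge_level (j : nat) := if (j < p)%N then (p - j.+1)%N else (j - p)%N.

Let x (v : W) : R :=
  match v with
  | inl (inl i) => ray_weight (level i)
  | inl (inr (j, _)) => ray_edge_weight (edge_level j) / (s + 1)
  | inr _ => (1 + leaf M s) / (s + 1)
  end.

Lemma level_edge j : (j < d)%N ->
  (level j = edge_level j /\ level j.+1 = (edge_level j).+1) \/
  (level j.+1 = edge_level j /\ level j = (edge_level j).+1).
Proof. by rewrite /d /level /edge_level; case: (ltnP j p); lia. Qed.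

Lemma edge_level_lt j : (j < d)%N -> (edge_level j < p)%N.
Proof. by rewrite /d /edge_level; case: (ltnP j p); lia. Qed.

Let sum_path_edge (j : 'I_d) :
  \sum_(u in @Td_edge m d c (inl j)) x u = ray_edge_weight (edge_level j).
Proof.
rewrite big_sumType /= [X in _ + X]big_pred0 ?addr0; last first.
  by move=> t; rewrite mem_path_edge_attached.
rewrite big_sumType /=.
have jd := ltn_ord j.
rewrite (eq_bigl (fun i : 'I_d.+1 => (i == j :> nat) || (i == j.+1 :> nat))); last first.
  by move=> i; rewrite mem_path_edge inE.
rewrite (bigD1 (widen_ord (leqnSn d) j)) /= ?eqxx //.
rewrite (big_pred1 (lift ord0 j)) /=; last first.
  move=> i; rewrite -[RHS](inj_eq val_inj) -val_eqE /= /bump /=; lia.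
rewrite [X in _ + X = _](_ : _ = (M - 1) * (ray_edge_weight (edge_level j) / (s + 1))); last first.
  rewrite (eq_bigl (fun ja : 'I_d * 'I_(m - 2) => ja.1 == j)); last first.
    by move=> [i b]; rewrite mem_path_edge inE.
  rewrite (eq_bigr (fun=> ray_edge_weight (edge_level j) / (s + 1))); last first.
    by move=> [i b] /= /eqP->.
  rewrite sumr_const (_ : #|_| = (m - 2)%N).
    by rewrite -mulr_natl natrB // /M; congr (_ * _); ring.
  rewrite -[RHS](card_ord (m - 2)) -[RHS]mul1n -(card1 j) -cardX.
  by apply: eq_card => -[i b]; rewrite !inE andbT.
rewrite [in RHS]ray_edge_weightE ?edge_level_lt //; congr (_ + _).
rewrite /bump /= add1n; case: (level_edge jd) => -[-> ->] //; exact: addrC.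
Qed.

Let tag_center (t : {v : loose_path_vertex m d & 'I_(Td_mult c v)}) :
  exists2 i : 'I_d.+1, tag t = inl i & i = p :> nat.
Proof.
case: t => -[i|q] [a /= ha] /=; last by [].
exists i => //; move: ha; rewrite /c; case: ifP => // _; by case: eqP => // -[->].
Qed.

Let level_center : level p = 0%N. Proof. by rewrite /level subnn. Qed.

Let sum_attached_edge t : \sum_(u in @Td_edge m d c (inr t)) x u = 1 + leaf M s.
Proof.
rewrite big_sumType /= (big_pred1 (tag t)) => [|u]; last exact: mem_attached_path.
have [i -> ip] := tag_center t; rewrite ip level_center /=; congr (_ + _).
rewrite (eq_bigl (fun tb : _ * 'I_(m - 1) => tb.1 == t)) => [|tb]; last exact: mem_attached.
rewrite sumr_const (_ : #|_| = (m - 1)%N).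
  by rewrite -mulr_natl natrB ?(ltnW m2) // -/M mulrCA leaf_edge.
rewrite -[RHS](card_ord (m - 1)) -[RHS]mul1n -(card1 t) -cardX.
by apply: eq_card => -[t' b]; rewrite !inE andbT.
Qed.

Lemma sum_incident (F : nat -> R) i : (i <= d)%N ->
  \sum_(j < d | (i == j :> nat) || (i == j.+1 :> nat)) F j
    = (if (0 < i)%N then F i.-1 else 0) + (if (i < d)%N then F i else 0).
Proof.
move=> id; rewrite (bigID (fun j : 'I_d => i == j :> nat)) [RHS]addrC; congr (_ + _).
  rewrite (eq_bigl (fun j : 'I_d => j == i :> nat)) ?big_ord1_eq // => j; lia.
rewrite (eq_bigl (fun j : 'I_d => (0 < i)%N && (j == i.-1 :> nat))) => [|j]; last first.
  by case: (i) => [|i']; lia.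
case: posnP => [->|i0]; first by rewrite big_pred0.
by rewrite big_ord1_eq ifT //; lia.
Qed.

Lemma sum_incident_level i : (i <= d)%N ->
  \sum_(j < d | (i == j :> nat) || (i == j.+1 :> nat))
      (ray_edge_weight (edge_level j) - ray_weight (level i))
    = if i == p then 2 * ray M s p else s * ray_weight (level i).
Proof.
move=> id; rewrite (sum_incident (fun j => ray_edge_weight (edge_level j) - ray_weight (level i))) //.
have w0 : ray_edge_weight 0 = 1 + ray M s p by rewrite /ray_edge_weight subn0 mul1r.
have wp : ray_edge_weight p = ray_weight p.
  by rewrite /ray_edge_weight subnn addr0 mulr1.
case: (ltngtP i p) => ip.
- have -> : (i < d)%N by rewrite /d; lia.
  have li : level i = (p - i)%N by rewrite /level; lia.
  have e0 : edge_level i = (p - i).-1 by rewrite /edge_level ip subnS.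
  rewrite li e0 -(@ray_weight_vertex (p - i)); last by lia.
  rewrite addrC; congr (_ + _); case: posnP => [->|i0].
    by rewrite subn0 wp subrr.
  by rewrite /edge_level ifT; [congr (ray_edge_weight _ - _)|]; lia.
- have i0 : (0 < i)%N by lia.
  have li : level i = (i - p)%N by rewrite /level; lia.
  have e0 : edge_level i.-1 = (i - p).-1 by rewrite /edge_level ifF; lia.
  rewrite i0 li e0 -(@ray_weight_vertex (i - p)); last by rewrite /d in id; lia.
  congr (_ + _); case: ltnP => [id'|di].
    by rewrite /edge_level ifF //; lia.
  have -> : (i - p = p)%N by rewrite /d in id di; lia.
  by rewrite wp subrr.
- have -> : edge_level i.-1 = 0%N by rewrite /edge_level ip ifT; lia.
  have -> : edge_level i = 0%N by rewrite /edge_level ip ifF; lia.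
  have -> : (i < d)%N by rewrite /d; lia.
  by rewrite ip p1 level_center w0 /=; ring.
Qed.

Let kd : (d <= k)%N.
Proof.
rewrite /d -(ler_nat R) natrM; move: (kp).
have : 1 <= p%:R :> R by rewrite ler1n.
nra.
Qed.

Let sum_attached_at (u : loose_path_vertex m d) :
  \sum_(t : {v : loose_path_vertex m d & 'I_(Td_mult c v)} | u == tag t) (leaf M s)
    = (Td_mult c u)%:R * leaf M s.
Proof.
transitivity (\sum_(v | u == v) \sum_(j : 'I_(Td_mult c v)) leaf M s).
  by rewrite sig_big_dep; apply: eq_bigl => t; rewrite andbT.
rewrite (big_pred1 u) => [|v]; last by rewrite eq_sym.
by rewrite sumr_const card_ord mulr_natl.
Qed.

(** [x] is an eigenvector: away from the centre the weights were chosen to satisfy the equation, and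
    at the centre it is the defining equation of [s]. *)
Lemma le_lambda1_Td : s / (m%:R - 1) <= lambda1 R m (Td m d c).
Proof.
have M0 : M != 0 by rewrite gt_eqF //; move: (M1); lra.
have a0 : s + 1 != 0 by rewrite gt_eqF //; move: (M1) (sM); lra.
apply: (le_lambda1 (E := @Td_edge m d c) (x := x)) m2 (@Td_edges m d c) (@Td_edge_linear m d c) _ _.
  have hp : (p < d.+1)%N by rewrite /d; lia.
  by exists (inl (inl (Ordinal hp))); rewrite /= level_center oner_eq0.
move=> v; rewrite -/M [M * _]mulrC divfK // big_sumType /=.
under eq_bigr do rewrite sum_path_edge.
under [X in _ + X = _]eq_bigr do rewrite sum_attached_edge.
case: v => [[i|[j b]]|[t b]].
- rewrite (eq_bigl (fun j : 'I_d => (i == j :> nat) || (i == j.+1 :> nat))); last first.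
    by move=> j; rewrite mem_path_edge inE.
  have id : (i <= d)%N by rewrite -ltnS.
  rewrite sum_incident_level //.
  rewrite (eq_bigl (fun t => inl i == tag t)); last by move=> t; rewrite mem_attached_path.
  case: eqP => ip.
    rewrite [x _]/= ip level_center /=.
    rewrite (eq_bigr (fun=> leaf M s)) => [|t _]; last by ring.
    rewrite sum_attached_at /= /c ip eqxx ifT; last by rewrite /d; lia.
    by rewrite natrB // natrM mulr1 [RHS]sE; ring.
  rewrite big_pred0 ?addr0 // => t; have [i' -> ip'] := tag_center t.
  by apply/eqP => -[ii]; apply: ip; rewrite ii.
- rewrite (big_pred1 j) => [|j']; last by rewrite mem_path_edge inE eq_sym.
  rewrite big_pred0 ?addr0 => [|t]; last first.
    by rewrite mem_attached_path; have [i -> _] := tag_center t.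
  by rewrite /=; field.
- rewrite big_pred0 => [|j]; last by rewrite mem_path_edge_attached.
  rewrite (big_pred1 t) => [|t']; last by rewrite mem_attached eq_sym.
  by rewrite /=; field.
Qed.

End CentralTree.

(** * Recognition of the extremal hypertree *)

Lemma mem_nth_enum (T : finType) (A : {set T}) (x0 : T) (n : nat) : #|A| = n ->
  forall x, reflect (exists i : 'I_n, x = nth x0 (enum A) i) (x \in A).
Proof.
move=> An x; rewrite -mem_enum; apply: (iffP (nthP x0)) => [[i ]|[i ->]].
  by rewrite -cardE An => ilt <-; exists (Ordinal ilt).
by exists i => //; rewrite -cardE An.
Qed.

Section Isomorphism.
Variables (V : finType) (H : hypergraph V) (m p : nat).
Hypotheses (m2 : (2 <= m)%N) (Hunif : uniform H m) (Htree : hypertree H) (p1 : (0 < p)%N).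
Let d := (2 * p)%N.
Let k := #|edges H|.
Let c := fun i : nat => if i == p.+1 then (k - d)%N else 0%N.
Variables (v : nat -> V) (e : nat -> {set V}).
Hypothesis ch : edge_chain H d v e.
Let r := v p.
Hypothesis nr : non_pendant H r.
Hypotheses (n_forward : #|branch H r (e p)| = p) (n_backward : #|branch H r (e p.-1)| = p).
Hypothesis n_other : forall f, f \in edges H -> r \in f -> f != e p -> f != e p.-1 ->
  #|branch H r f| = 1%N.

Let pd : (p < d)%N. Proof. by rewrite /d mul2n -addnn -[X in (X < _)%N]addn0 ltn_add2l. Qed.
Let p_d : (p.-1 < d)%N. Proof. exact: leq_ltn_trans (leq_pred p) pd. Qed.

Let v_neq i : (i <= d)%N -> i != p -> v i != r.
Proof.
have [_ vinj _] := ch; move=> id; apply: contra => /eqP h.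
by apply/eqP/vinj; rewrite // inE ltnW.
Qed.

Let e_neq : e p.-1 != e p.
Proof.
have [_ _ einj] := ch; apply/eqP => /einj; rewrite !inE pd p_d => /(_ isT isT)/eqP.
by rewrite -(prednK p1) /= eqn_leq ltnn andbF.
Qed.

Let re : r \in e p. Proof. by have [eE _ _] := ch; case: (eE p pd). Qed.
Let re' : r \in e p.-1.
Proof. by have [eE _ _] := ch; case: (eE p.-1 p_d) => _ _; rewrite prednK. Qed.

Let forward i : (p <= i < d)%N -> e i \in branch H r (e p).
Proof.
have [eE _ _] := ch; move=> /andP[/subnKC<-]; elim: (i - p)%N => [|j IHj] hd.
  by rewrite addn0 branch_refl.
rewrite addnS in hd *; have [eH _ vi] := eE _ (ltnW hd); have [eH' vi' _] := eE _ hd.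
apply: (branch_step (IHj (ltnW hd)) eH eH' _ vi vi'); apply: v_neq; first exact: ltnW.
by rewrite -addnS -[X in _ != X]addn0 eqn_add2l.
Qed.

Let backward i : (i < p)%N -> e i \in branch H r (e p.-1).
Proof.
have [eE _ _] := ch; move=> ip; have [j ->] : exists j, i = (p.-1 - j)%N.
  by exists (p.-1 - i)%N; rewrite subKn // -ltnS prednK.
elim: j => [|j IHj]; first by rewrite subn0 branch_refl.
case: (posnP (p.-1 - j)) => [j0|jpos].
  by move: IHj; rewrite subnS j0.
have hd : (p.-1 - j < d)%N by apply: leq_ltn_trans p_d; apply: leq_subr.
have [eH vi _] := eE _ hd; have hd' : ((p.-1 - j).-1 < d)%N by apply: leq_ltn_trans hd; apply: leq_pred.
have [eH' _ vi'] := eE _ hd'; rewrite prednK // in vi'; rewrite subnS.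
apply: (branch_step IHj eH eH' _ vi vi'); apply: v_neq; first exact: ltnW.
by rewrite neq_ltn (leq_ltn_trans (leq_subr _ _)) // prednK.
Qed.

(** A branch with only as many edges as the piece of path inside it consists of that piece. *)
Let chain_part a b (A : {set {set V}}) : (a + b <= d)%N -> #|A| = b ->
  (forall i, (a <= i < a + b)%N -> e i \in A) ->
  forall f, f \in A -> exists2 i, (i < d)%N & f = e i.
Proof.
have [_ _ einj] := ch; move=> abd Ab eA f fA.
have AE : [set e (a + i)%N | i : 'I_b] = A.
  apply/eqP; rewrite eqEcard Ab card_imset ?card_ord ?leqnn ?andbT.
    by apply/subsetP => _ /imsetP[i _ ->]; apply: eA; rewrite leq_addr ltn_add2l ltn_ord.
  move=> i j /einj; rewrite !inE => h; apply/val_inj/eqP.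
  rewrite -(eqn_add2l a); apply/eqP/h; by apply: leq_trans abd; rewrite ltn_add2l ltn_ord.
move: fA; rewrite -AE => /imsetP[i _ ->]; exists (a + i)%N => //.
by apply: leq_trans abd; rewrite ltn_add2l ltn_ord.
Qed.

Let others := [set f in edges H | [&& r \in f, f != e p & f != e p.-1]].

Let edges_cover f : f \in edges H -> (exists2 i, (i < d)%N & f = e i) \/ f \in others.
Proof.
move=> fH; have [g [gH rg fg]] := branch_cover m2 Hunif Htree r fH.
have [gp|gp] := eqVneq g (e p).
  left; rewrite gp in fg; apply: (@chain_part p p (branch H r (e p))) => //.
    by rewrite addnn -mul2n.
  by move=> i; rewrite addnn -mul2n; apply: forward.
have [gp'|gp'] := eqVneq g (e p.-1).
  left; rewrite gp' in fg; apply: (@chain_part 0 p (branch H r (e p.-1))) => //.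
    exact: ltnW.
right; have /eqP/cards1P[h hE] := n_other gH rg gp gp'.
have := branch_refl H r g; rewrite hE inE => /eqP gh.
by move: fg; rewrite hE !inE => /eqP->; rewrite -gh gH rg gp.
Qed.

Let card_others : #|others| = (k - d)%N.
Proof.
have [eE _ _] := ch; have [eH _ _] := eE p pd; have [eH' _ _] := eE p.-1 p_d.
have := sum_card_branch_eq m2 Hunif Htree r.
rewrite (bigD1 (e p)) ?eH //= (bigD1 (e p.-1)) ?eH' ?re' //= n_forward n_backward addnA addnn -mul2n.
rewrite (eq_bigr (fun=> 1%N)) => [|f /andP[/andP[/andP[fH rf] f1] f2]]; last exact: n_other.
rewrite sum1_card -/k => <-; rewrite addKn; apply: eq_card => f.
rewrite inE -[RHS]/((f \in edges H) && (r \in f) && (f != e p) && (f != e p.-1)).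
by rewrite -!andbA.
Qed.

Let W : finType := attach_vertex m (Td_mult (m := m) (d := d) c).

Let mult_center (t : {u : loose_path_vertex m d & 'I_(Td_mult c u)}) :
  tag t = inl (inord p) /\ (tagged t < k - d)%N.
Proof.
case: t => -[i|q] [a /= ha] /=; last by [].
move: ha; rewrite /c; case: ifP => // _; case: eqP => // -[ip] ha; split=> //.
by congr inl; apply/val_inj; rewrite /= inordK ?ip // ltnS ltnW.
Qed.

Let edge_at (j : 'I_d + {u : loose_path_vertex m d & 'I_(Td_mult c u)}) : {set V} :=
  match j with
  | inl j => e j
  | inr t => nth set0 (enum others) (tagged t)
  end.

(** Enumerating each edge without its joints names its remaining vertices. The index ranges have
    exactly these sizes, so the default of [nth] is never taken. *)
Let phi (w : W) : V :=
  match w with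
  | inl (inl i) => v i
  | inl (inr (j, a)) => nth r (enum (e j :\ v j :\ v j.+1)) a
  | inr (t, b) => nth r (enum (edge_at (inr t) :\ r)) b
  end.

Let edge_at_others t : edge_at (inr t) \in others.
Proof.
by rewrite -mem_enum mem_nth // -cardE card_others; case: (mult_center t).
Qed.

Let card_inner (j : 'I_d) : #|e j :\ v j :\ v j.+1| = (m - 2)%N.
Proof.
have [eE vinj _] := ch; have [eH vj vj1] := eE j (ltn_ord j).
rewrite -(Hunif eH) (cardsD1 (v j) (e j)) vj (cardsD1 (v j.+1) (e j :\ v j)) !inE vj1.
have -> : v j.+1 != v j.
  apply/eqP => /vinj; rewrite !inE ltn_ord ltnW ?ltn_ord // => /(_ isT isT)/eqP.
  by rewrite eqn_leq ltnn.
by rewrite !add1n subn2.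
Qed.

Let card_outer t : #|edge_at (inr t) :\ r| = (m - 1)%N.
Proof.
have := edge_at_others t; rewrite inE => /and4P[fH rf _ _].
by have := Hunif fH; rewrite (cardsD1 r) rf add1n subn1 => /(congr1 predn).
Qed.

Let phi_edge j : [set phi w | w in @Td_edge m d c j] = edge_at j.
Proof.
have [eE _ _] := ch; apply/setP => x; apply/imsetP/idP => [[w]|].
  case: j => [j|t]; case: w => [u|[t' b]].
  - rewrite mem_path_edge inE; have [eH vj vj1] := eE j (ltn_ord j).
    case: u => [i /orP[]/eqP ij ->|[j' a] /= /eqP -> ->] /=; rewrite ?ij //.
    have : nth r (enum (e j :\ v j :\ v j.+1)) a \in e j :\ v j :\ v j.+1.
      by rewrite -mem_enum mem_nth // -cardE card_inner.
    by rewrite !inE => /and3P[].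
  - by rewrite mem_path_edge_attached.
  - rewrite mem_attached_path => /eqP-> ->; have [tE _] := mult_center t; rewrite tE.
    have := edge_at_others t; rewrite inE => /and4P[_ rf _ _].
    by rewrite /= inordK // ltnS ltnW.
  - rewrite mem_attached => /eqP /= -> ->.
    have : nth r (enum (edge_at (inr t) :\ r)) b \in edge_at (inr t) :\ r.
      by rewrite -mem_enum mem_nth // -cardE card_outer.
    by rewrite !inE => /andP[].
case: j => [j|t] xe.
  have [->|xv] := eqVneq x (v j).
    exists (inl (inl (widen_ord (leqnSn d) j))) => //.
    by rewrite mem_path_edge inE eqxx.
  have [->|xv1] := eqVneq x (v j.+1).
    exists (inl (inl (lift ord0 j))) => //.
    by rewrite mem_path_edge inE /= /bump /= add1n eqxx orbT.
  have /(mem_nth_enum r (card_inner j))[a ->] : x \in e j :\ v j :\ v j.+1.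
    by rewrite !inE xv xv1.
  by exists (inl (inr (j, a))) => //; rewrite mem_path_edge inE.
have [->|xr] := eqVneq x r.
  exists (inl (tag t)); first by rewrite mem_attached_path.
  by have [tE _] := mult_center t; rewrite tE /= inordK // ltnS ltnW.
have /(mem_nth_enum r (card_outer t))[b ->] : x \in edge_at (inr t) :\ r by rewrite !inE xr.
by exists (inr (t, b)) => //; rewrite mem_attached.
Qed.

Let edge_at_onto f : f \in edges H -> exists j, f = edge_at j.
Proof.
case/edges_cover => [[i id ->]|/(mem_nth_enum set0 card_others)[t ->]].
  by exists (inl (Ordinal id)).
have hp : (p < d.+1)%N by apply: ltnW.
have hc : Td_mult (m := m) (d := d) c (inl (Ordinal hp)) = (k - d)%N.
  by rewrite /= /c eqxx ifT // ltnS p1.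
pose t' : {u : loose_path_vertex m d & 'I_(Td_mult c u)} :=
  Tagged (fun u => 'I_(Td_mult c u)) (cast_ord (esym hc) t).
by exists (inr t').
Qed.

Let phi_onto x : exists w, phi w = x.
Proof.
have [f fH xf] := vertex_covered Htree x nr.
have [j fE] := edge_at_onto fH; move: xf; rewrite fE -phi_edge => /imsetP[w _ ->].
by exists w.
Qed.

(** T_d has (d + 1) + d (m - 2) + (k - d)(m - 1) = k (m - 1) + 1 vertices, the lower bound of
    [card_vertices]. *)
Let card_W : (#|W| <= #|V|)%N.
Proof.
have kd : (d <= k)%N.
  rewrite -[d]subn0; apply: (card_chain_edges ch); first by rewrite leqnn.
  by move=> i /andP[_ id]; have [eE _ _] := ch; case: (eE i id).
have sum_mult : (\sum_(u : loose_path_vertex m d) Td_mult c u = k - d)%N.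
  rewrite big_sumType /= addnC big1 ?add0n // (bigD1 (inord p)) //= inordK; last first.
    by rewrite ltnS ltnW.
  rewrite /c eqxx ifT ?ltnS ?p1 // big1 ?addn0 // => i ip.
  case: ifP => // _; case: eqP => // -[pi]; case/eqP: ip.
  by apply/val_inj; rewrite /= inordK // ltnS ltnW.
have cardT : #|{: {u : loose_path_vertex m d & 'I_(Td_mult c u)}}| = (k - d)%N.
  rewrite -sum_mult -sum1_card.
  transitivity (\sum_(u : loose_path_vertex m d) \sum_(j : 'I_(Td_mult c u)) 1)%N.
    by rewrite sig_big_dep.
  by apply: eq_bigr => u _; rewrite sum1_card card_ord.
have := card_vertices m2 Hunif Htree (ex_intro _ r nr); rewrite -/k => lt.
rewrite card_sum card_prod cardT card_sum card_prod !card_ord.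
apply: leq_trans lt; rewrite -[X in (_ <= (X * _).+1)%N](subnKC kd).
move: (k - d)%N (d) (m) m2 => a b; clear=> -[|[|m']] // _.
by rewrite !subSS !subn0 /= mulnDl !mulnS; lia.
Qed.

Lemma isomorphic_Td : isomorphic H (Td m d c).
Proof.
(* A right inverse of the surjection [phi] is injective, hence bijective by the count; it is the
   isomorphism sought. *)
have ex x : exists w, phi w == x by have [w <-] := phi_onto x; exists w.
pose psi x := xchoose (ex x).
have psiK : cancel psi phi by move=> x; apply/eqP/(xchooseP (ex x)).
have psi_bij : bijective psi := inj_card_bij (can_inj psiK) card_W.
have phiK : cancel phi psi.
  by have [g gK psig] := psi_bij => w; rewrite -[w]psig psiK.
exists psi => //; apply/setP => f; rewrite Td_edges.
have psi_edge j : psi @: edge_at j = @Td_edge m d c j.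
  by rewrite -phi_edge -imset_comp (eq_imset _ phiK) imset_id.
apply/imsetP/existsP => [[g /edge_at_onto[j ->] ->]|[j /eqP->]].
  by exists j; rewrite psi_edge.
exists (edge_at j) => //.
case: j => [j|t] /=; first by have [eE _ _] := ch; case: (eE j (ltn_ord j)).
by have := edge_at_others t; rewrite inE => /andP[].
Qed.

End Isomorphism.

(** * The cases d = 0 and d > 0 *)

Lemma lambda1_no_edges (R : realType) (m : nat) (V : finType) (H : hypergraph V) :
  (0 < #|V|)%N -> edges H = set0 -> lambda1 R m H = 0.
Proof.
move=> V0 E0; have [z /eigenvalueP[y yA y0] [zE _]] := spectral_radius_max (adjacency R m H) V0.
rewrite /lambda1 zE; suff -> : z = 0 by apply: ComplexField.Normc.normc0.
have A0 : adjacency R m H = 0.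
  apply/matrixP => i j; rewrite !mxE; case: ifP => // /andP[_ /existsP[e]].
  by rewrite E0 inE.
move: yA; rewrite A0 map_mx0 mulmx0 => /esym/eqP.
by rewrite scaler_eq0 (negPf y0) orbF => /eqP.
Qed.

Lemma diameter0_unique (V : finType) (H : hypergraph V) :
  connected_hypergraph H -> diameter H 0 -> forall u w : V, u = w.
Proof.
move=> Hconn [_ dmax] u w; have [n jn] := Hconn u w.
have [n0 [j0 min0]] : exists n0, distance H u w n0.
  elim/ltn_ind: n jn => n IHn jn.
  have [[n' [lt jn']]|none] := EM (exists n', (n' < n)%N /\ joined_by H u w n').
    exact: IHn jn'.
  exists n; split=> // n' jn'; rewrite leqNgt; apply/negP => lt; apply: none.
  by exists n'.
have := dmax u w n0 (conj j0 min0); rewrite leqn0 => /eqP n00; rewrite n00 in j0.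
by case: j0 => -[|x s] [].
Qed.

Section Cases.
Variables (R : realType) (m p : nat) (V : finType) (T : hypergraph V).
Hypotheses (m2 : (2 <= m)%N) (Hunif : uniform T m) (Htree : hypertree T).
Let k := #|edges T|.
Let d := (2 * p)%N.
Let c := fun i : nat => if i == p.+1 then (k - d)%N else 0%N.
Hypothesis Hdiam : diameter T d.

(** Diameter 0 leaves a single vertex and, as m >= 2, no edge; T_d degenerates in the same way. *)
Lemma diameter0_case : p = 0%N ->
  lambda1 R m T = 0 /\ lambda1 R m (Td m d c) = 0 /\ isomorphic T (Td m d c).
Proof.
move=> p0; have d0 : d = 0%N by rewrite /d p0 muln0.
have [Hconn _ _ _] := Htree.
have uniqV : forall u w : V, u = w by apply: diameter0_unique Hconn _; rewrite -d0.
have [[v0 _] _] := Hdiam.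
have noT : edges T = set0.
  apply/setP => e; rewrite inE; apply: contraTF isT => eH.
  have /card_gt1P[a [b [_ _ ab]]] : (1 < #|e|)%N by rewrite Hunif.
  by rewrite (uniqV a b) eqxx in ab.
have noJ (P : Prop) : ('I_d + {u : loose_path_vertex m d & 'I_(Td_mult c u)})%type -> P.
  case=> [[i id]|[[i|q] [a /= ha]]] //; first by rewrite d0 in id.
  by move: ha; case: ifP => // /andP[_ id]; have := leq_trans id (eq_leq d0).
have noTd : edges (Td m d c) = set0.
  by apply/setP => e; rewrite Td_edges inE; apply/existsP => -[j _]; apply: (noJ _ j).
pose w0 : attach_vertex m (Td_mult (m := m) (d := d) c) := inl (inl ord0).
split; [|split].
- by apply: lambda1_no_edges noT; apply/card_gt0P; exists v0.
- by apply: lambda1_no_edges noTd; apply/card_gt0P; exists w0.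
exists (fun=> w0); last by rewrite noT noTd imset0.
exists (fun=> v0) => [x|w] //.
case: w => [[i|[j a]]|[t b]]; [|exact: noJ (inl j)|exact: noJ (inr t)].
by congr (inl (inl _)); apply/val_inj; have := ltn_ord i; rewrite {2}d0 /=; case: (i : nat).
Qed.

Hypothesis p1 : (0 < p)%N.
Hypothesis hk : ((4 * (2 * p)%:R ^+ 2 - 1) * (m%:R - 1) + 2) / 4 <= k%:R :> R.

(** The value l = s / (m - 1) separates the two spectral radii, so their equality forces both to be
    l. *)
Lemma diameter_gt0_case : exists l : R,
  [/\ l <= lambda1 R m (Td m d c), lambda1 R m T <= l, lambda1 R m T = l -> isomorphic T (Td m d c)
    & l < (m%:R - 1 + Num.sqrt ((m%:R - 1) ^+ 2 + 4 * (k%:R - d%:R) * (m%:R - 1)))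
          / (2 * m%:R - 2)].
Proof.
have M1 : 1 <= m%:R - 1 :> R by rewrite lerBrDr -[1 + 1]/(2%:R) ler_nat.
have kp := lt_of_diameter_bound M1 hk p1.
have [s [sM Ns sE s_lt]] := exists_center_solution M1 p1 hk.
have [[u [w [[t [ht _ td]] _]]] _] := Hdiam.
have ch := hpath_edge_chain ht; rewrite td in ch.
set v := nth u _ in ch; set e := nth set0 _ in ch.
have [eE _ einj] := ch.
have d1 : (1 < d)%N by rewrite /d (@leq_mul 2 1).
have np : exists v, non_pendant T v.
  exists (v 1%N); apply/non_pendantP; exists (e 0%N), (e 1%N).
  have [e0 _ v0] := eE 0%N (ltnW d1); have [e1 v1 _] := eE 1%N d1.
  by split=> //; apply/eqP => /einj; rewrite !inE d1 (ltnW d1) => /(_ isT isT).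
have [r nr cr] := exists_centroid m2 Hunif Htree np.
have V0 : (0 < #|V|)%N by apply/card_gt0P; exists r.
have [z [z0 zn0 zsub]] := lambda1_subsolution R T m2 V0.
pose l := s / (m%:R - 1); exists l.
have lM : (m%:R - 1) * l = s by rewrite mulrC divfK // gt_eqF //; lra.
(* Under this assumption [z] is also a subsolution for [s]; [centroid_rigid] then gives the reverse
   inequality and the structure of [T]. *)
have rigid : l <= lambda1 R m T ->
    lambda1 R m T <= l /\ isomorphic T (Td m d c).
  move=> le; have s_sub x : s * z x <= \sum_(f in edges T | x \in f) edge_sum z x f.
    apply: le_trans (zsub x); rewrite -lM ler_wpM2r // ler_wpM2l //; lra.
  have zr := centroid_gt0 m2 Hunif Htree p1 kp sM Ns z0 s_sub zn0 nr cr.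
  have [sumle rE nf nb no] := centroid_rigid m2 Hunif Htree p1 kp sM Ns z0 s_sub zn0 sE ch nr cr.
  rewrite rE in nr nf nb no; split; last exact: (isomorphic_Td m2 Hunif Htree p1 ch nr nf nb no).
  have := le_trans (zsub r) sumle; rewrite ler_pM2r // -lM ler_pM2l //; lra.
split.
- exact: (le_lambda1_Td m2 p1 kp sM Ns sE).
- by case: (leP l (lambda1 R m T)) => [/rigid[]|/ltW].
- by move=> lE; case: (rigid _); rewrite ?lE.
- rewrite /l /d [in X in _ < X]natrM.
  have -> : 2 * m%:R - 2 = 2 * (m%:R - 1) :> R by ring.
  by rewrite invfM mulrA ltr_pM2r // invr_gt0; lra.
Qed.

End Cases.

Theorem theorem2p1p3 (R : realType) (m k d p : nat) (V : finType)
    (T : hypergraph V) (hm : (2 <= m)%N)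
    (hunif : uniform T m) (htree : hypertree T)
    (hk : #|edges T| = k) (hd : d = (2 * p)%N) (hdiam : diameter T d)
    (hkd : ((4 * d%:R ^+ 2 - 1) * (m%:R - 1) + 2) / 4 <= k%:R :> R) :
  let T0 := Td m d (fun i => if i == p.+1 then (k - d)%N else 0%N) in
  [/\ lambda1 R m T <= lambda1 R m T0,
      lambda1 R m T = lambda1 R m T0 -> isomorphic T T0
    & lambda1 R m T <
        (m%:R - 1 + Num.sqrt ((m%:R - 1) ^+ 2
                              + 4 * (k%:R - d%:R) * (m%:R - 1)))
        / (2 * m%:R - 2)].
Proof.
subst k d => T0.
have [p0|p1] := posnP p.
  have [l0 [l0' iso]] := diameter0_case R hm hunif htree hdiam p0.
  rewrite l0 /T0 l0'; split=> //.
  (* For d = 0 the spectral radius is 0, so (ii) only asks for a positive bound. *)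
  have M1 : 1 <= m%:R - 1 :> R by rewrite lerBrDr -[1 + 1]/(2%:R) ler_nat.
  by apply: divr_gt0; [apply: ltr_wpDr; rewrite ?sqrtr_ge0|]; lra.
have [l [lT0 lT iso lt]] := diameter_gt0_case hm hunif htree hdiam p1 hkd.
split; [exact: le_trans lT0| |exact: le_lt_trans lt].
by move=> eq; apply: iso; apply/eqP; rewrite eq_le lT eq.
Qed.
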